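(* In the dilute Curie–Weiss model with fixed $p\in(0,1)$, the dynamical order parameter $q_D(N)=\mathbb E_{\sigma(0),\mathcal J}\big[(\mathbb E_\omega[\sigma_1(\infty)])^2\big]$ satisfies $$\lim_{N\to\infty}q_D(N)=1 .$$ In fact, the stronger statement $$\lim_{N\to\infty}\mathbb E_{\sigma(0)}\Big[\big(\mathbb E_{\mathcal J,\omega}[\sigma_1(\infty)]\big)^2\Big]=1$$ holds.
   Context: Model. For each $N$ let $(J_{ij})_{1\le i<j\le N}$ be i.i.d. $\mathrm{Bernoulli}(p)$, $J_{ji}=J_{ij}$, with expectation $\mathbb E_{\mathcal J}$, and $H(\sigma)=-\frac1N\sum_{1\le i<j\le N}J_{ij}\sigma_i\sigma_j$ for $\sigma\in\{\pm1\}^N$. Zero-temperature dynamics. Given the couplings, $\sigma(t)=(\sigma_1(t),\dots,\sigma_N(t))$ is the discrete-time Markov chain on $\{\pm1\}^N$ with $P(\sigma,\sigma^{(i)})=\frac1N\big[\mathbf 1\{H(\sigma^{(i)})<H(\sigma)\}+\frac12\mathbf 1\{H(\sigma^{(i)})=H(\sigma)\}\big]$ for each $i$, where $\sigma^{(i)}$ is $\sigma$ with spin $i$ flipped, and otherwise staying put. $\mathbb E_\omega$ is expectation over the evolution of the chain given couplings and initial state; $\mathbb E_{\mathcal J,\omega}$ averages over both couplings and evolution with the initial state fixed. The initial state $\sigma(0)$ is uniform on $\{\pm1\}^N$ (product measure), independent of the couplings, with expectation $\mathbb E_{\sigma(0)}$. $\sigma_1(\infty)=\lim_{t\to\infty}\sigma_1(t)$,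 with the convention $\sigma_1(\infty)=0$ if the limit does not exist. *)

(* Defs.v *)
From HB Require Import structures.
From mathcomp Require Import all_boot all_order all_algebra.
From mathcomp Require Import all_classical all_reals all_analysis.
From mathcomp Require Import ring lra.

Set Implicit Arguments.
Unset Strict Implicit.
Unset Printing Implicit Defensive.

Import Order.TTheory GRing.Theory Num.Theory.
Import numFieldNormedType.Exports.

Local Open Scope classical_set_scope.
Local Open Scope ring_scope.

(* [true] encodes the spin +1 and [false] the spin -1. *)
Definition config (N : nat) : finType := {ffun 'I_N -> bool}.

Definition spin (R : realType) (N : nat) (s : config N) (i : 'I_N) : R :=
  if s i then 1 else -1.

Definition flip (N : nat) (s : config N) (i : 'I_N) : config N :=
  [ffun j => if j == i then ~~ s j else s j].

(* The pairs i < j; a coupling J_ij = J_ji is stored once, at (i, j) with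
   i < j. *)
Definition edge (N : nat) : finType := {e : 'I_N * 'I_N | (e.1 < e.2)%N}.

Definition couplings (N : nat) : finType := {ffun edge N -> bool}.

Definition hamiltonian (R : realType) (N : nat) (J : couplings N)
    (s : config N) : R :=
  - N%:R^-1 * \sum_(e : edge N)
      (J e)%:R * spin R s (val e).1 * spin R s (val e).2.

Definition flip_prob (R : realType) (N : nat) (J : couplings N)
    (s : config N) (i : 'I_N) : R :=
  N%:R^-1 * ((hamiltonian R J (flip s i) < hamiltonian R J s)%R%:R +
             2^-1 * (hamiltonian R J (flip s i) == hamiltonian R J s)%:R).

Definition zero_temp_kernel (R : realType) (N : nat) (J : couplings N)
    (s s' : config N) : R :=
  if s' == s then 1 - \sum_(i < N) flip_prob R J s i
  else \sum_(i < N | s' == flip s i) flip_prob R J s i.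

Definition is_markov_chain (R : realType) (S : finType) (K : S -> S -> R)
    (s0 : S) (d : measure_display) (T : measurableType d)
    (P : probability T R) (X : nat -> T -> S) : Prop :=
  [/\ forall t s, measurable [set w | X t w = s],
      P [set w | X 0%N w = s0] = 1%E &
      forall t (x : nat -> S),
        P [set w | forall i, (i <= t.+1)%N -> X i w = x i] =
        (P [set w | forall i, (i <= t)%N -> X i w = x i] *
         (K (x t) (x t.+1))%:E)%E].

(* A Markov chain with kernel K started at s0, on some probability space. *)
Record markov_chain (R : realType) (S : finType) (K : S -> S -> R) (s0 : S) :=
  MarkovChain {
    chain_display : measure_display;
    chain_space : measurableType chain_display;
    chain_prob : probability chain_space R;
    chain_state :> nat -> chain_space -> S;
    chainP : is_markov_chain K s0 chain_prob chain_state }.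

Definition zero_temp_dynamics (R : realType) (N : nat) (J : couplings N)
    (s0 : config N) := markov_chain (zero_temp_kernel R J) s0.

Definition lim_or0 (R : realType) (u : nat -> R) : R :=
  if `[< cvgn u >] then limn u else 0.

Definition E_omega (R : realType) (n : nat) (J : couplings n.+1)
    (s0 : config n.+1) (X : zero_temp_dynamics R J s0) : R :=
  fine ('E_(chain_prob X)[fun w => lim_or0 (fun t => spin R (X t w) ord0)])%E.

Definition E_couplings (R : realType) (p : R) (N : nat)
    (f : couplings N -> R) : R :=
  \sum_(J : couplings N) (\prod_(e : edge N) bernoulli_pmf p (J e)) * f J.

Definition E_init (R : realType) (N : nat) (f : config N -> R) : R :=
  #|config N|%:R^-1 * \sum_(s : config N) f s.

Definition q_D (R : realType) (p : R) (n : nat)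
    (X : forall (J : couplings n.+1) (s0 : config n.+1),
         zero_temp_dynamics R J s0) : R :=
  E_init (fun s0 => E_couplings p (fun J => E_omega (X J s0) ^+ 2)).

Definition q_D_annealed (R : realType) (p : R) (n : nat)
    (X : forall (J : couplings n.+1) (s0 : config n.+1),
         zero_temp_dynamics R J s0) : R :=
  E_init (fun s0 => (E_couplings p (fun J => E_omega (X J s0))) ^+ 2).

(* Realizations exist, so that quantifying over all of them is not vacuous:
   cut [0, 1[, with Lebesgue measure, into nested intervals whose lengths are
   the probabilities of the finite trajectories. *)
Section existence.
Context (R : realType) (S : finType) (K : S -> S -> R) (s0 : S).
Hypothesis K0 : forall x y, 0 <= K x y.
Hypothesis K1 : forall x, \sum_y K x y = 1.

Let unit_itv : set (measurableTypeR R) := `[0, 1[%classic.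

Let munit : measurable unit_itv. Proof. exact: measurable_itv. Qed.

Definition unit_measure : set (measurableTypeR R) -> \bar R :=
  mrestr lebesgue_measure munit.

HB.instance Definition _ := Measure.on unit_measure.

Let unit_measureT : unit_measure setT = 1%E.
Proof.
rewrite /unit_measure /mrestr setTI /unit_itv lebesgue_measure_itv /= lte_fin.
by rewrite ltr01 oppr0 adde0.
Qed.

HB.instance Definition _ :=
  Measure_isProbability.Build _ _ R unit_measure unit_measureT.

Let rk (z : S) : nat := enum_rank z.

Let rk_inj : injective rk.
Proof. by move=> y z /val_inj/enum_rank_inj. Qed.

Let F (x y : S) : R := \sum_(z | (rk z < rk y)%N) K x z.

Let F_ge0 x y : 0 <= F x y.
Proof. exact: sumr_ge0. Qed.

Let F_le1 x y : F x y + K x y <= 1.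
Proof.
rewrite -(K1 x) [leRHS](bigID (fun z => (rk z < rk y)%N)) /=.
rewrite lerD2l (bigD1 y) ?ltnn//= lerDl; exact: sumr_ge0.
Qed.

Let F_disj x y y' : (rk y < rk y')%N -> F x y + K x y <= F x y'.
Proof.
move=> yy'; rewrite [leRHS]/F (bigID (fun z => (rk z < rk y)%N)) /=.
apply: lerD.
  rewrite le_eqVlt; apply/orP; left; apply/eqP/eq_bigl => z.
  by rewrite andb_idl// => /ltn_trans; apply.
rewrite (bigD1 y) ?yy' ?ltnn//= lerDl; exact: sumr_ge0.
Qed.

Let inI (x y : S) (v : R) := F x y <= v < F x y + K x y.

Let inI_uniq x y y' v : inI x y v -> inI x y' v -> y = y'.
Proof.
move=> /andP[a b] /andP[c d].
have [/(F_disj x) h|/(F_disj x) h|/rk_inj//] := ltngtP (rk y) (rk y').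
- by have := lt_le_trans b (le_trans h c); rewrite ltxx.
- by have := lt_le_trans d (le_trans h a); rewrite ltxx.
Qed.

Let inI_ex x v : 0 <= v < 1 -> exists y, inI x y v.
Proof.
move=> /andP[v0 v1].
pose c k := \sum_(z | (rk z < k)%N) K x z.
have cge k : (#|S| <= k)%N -> c k = 1.
  move=> Sk; rewrite -(K1 x); apply: eq_bigl => z.
  exact: leq_trans (ltn_ord (enum_rank z)) Sk.
have ex : exists k, v < c k by exists #|S|; rewrite cge.
case: (ex_minnP ex) => -[|j] vj minj.
  by move: vj; rewrite /c big_pred0// ltNge v0.
have cj : c j <= v.
  by rewrite leNgt; apply/negP => /minj; rewrite ltnn.
have jS : (j < #|S|)%N.
  by rewrite ltnNge; apply/negP => /cge cj1; rewrite cj1 leNgt v1 in cj.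
pose y := enum_val (Ordinal jS).
have rky : rk y = j by rewrite /rk /y enum_valK.
exists y; rewrite /inI.
have -> : F x y = c j by rewrite /F rky.
rewrite cj /=; apply: (lt_le_trans vj).
rewrite /c (bigD1 y) ?rky//= addrC lerD2r le_eqVlt; apply/orP; left.
apply/eqP/eq_bigl => z; rewrite ltnS [in RHS]ltn_neqAle andbC; congr andb.
rewrite -rky; by rewrite (inj_eq rk_inj).
Qed.

Let sub (z : S * R * R) (y : S) : S * R * R :=
  (y, z.1.2 + z.2 * F z.1.1 y, z.2 * K z.1.1 y).

Let mem (z : S * R * R) (u : R) := z.1.2 <= u < z.1.2 + z.2.

Let subP z y u : 0 < z.2 -> mem (sub z y) u = inI z.1.1 y ((u - z.1.2) / z.2).
Proof.
move=> z0; rewrite /mem /inI /sub /= ler_pdivlMr// ltr_pdivrMr//.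
by rewrite lerBrDl ltrBlDl -addrA -mulrDr ![_ * z.2]mulrC.
Qed.

Let sub_mem z y u : mem (sub z y) u -> 0 <= z.2 -> mem z u.
Proof.
move=> /andP[a b] z0; apply/andP; split.
  by apply: le_trans a; rewrite lerDl mulr_ge0.
apply: (lt_le_trans b); rewrite /= -addrA lerD2l -mulrDr.
by rewrite ler_piMr.
Qed.

Let mem_gt0 z u : mem z u -> 0 < z.2.
Proof. by move=> /andP[a b]; have := le_lt_trans a b; rewrite ltrDl. Qed.

Let step z u := if [pick y | mem (sub z y) u] is Some y then sub z y else z.

Let stepP z u y : mem z u -> mem (sub z y) u -> step z u = sub z y.
Proof.
move=> zu; have z0 := mem_gt0 zu; rewrite subP// => yu.
rewrite /step; case: pickP => [y'|/(_ y)]; rewrite subP// ?yu//.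
by move=> /(inI_uniq yu) ->.
Qed.

Let step_ex z u : mem z u -> exists2 y, step z u = sub z y & mem (sub z y) u.
Proof.
move=> zu; have z0 := mem_gt0 zu.
have [|y yu] := @inI_ex z.1.1 ((u - z.1.2) / z.2).
  move: zu => /andP[a b].
  by rewrite divr_ge0 ?subr_ge0 ?(ltW z0)//= ltr_pdivrMr// mul1r ltrBlDl.
by rewrite -subP// in yu; exists y => //; exact: stepP.
Qed.

Let z0 : S * R * R := (s0, 0, 1).

Fixpoint nested (u : R) (t : nat) : S * R * R :=
  if t is t'.+1 then step (nested u t') u else z0.

Fixpoint cell (x : nat -> S) (t : nat) : S * R * R :=
  if t is t'.+1 then sub (cell x t') (x t) else z0.

Let cell_bnd x t : [/\ 0 <= (cell x t).1.2, 0 <= (cell x t).2 &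
   (cell x t).1.2 + (cell x t).2 <= 1].
Proof.
elim: t => [|t [a b c]] /=; first by rewrite add0r.
split; first by rewrite addr_ge0// mulr_ge0.
- by rewrite mulr_ge0.
- by apply: le_trans c; rewrite -addrA lerD2l -mulrDr ler_piMr.
Qed.

Let cell1 x t : x 0%N = s0 -> (cell x t).1.1 = x t.
Proof. by case: t => /=. Qed.

Let nested_mem u t : 0 <= u < 1 -> mem (nested u t) u.
Proof.
move=> u01; elim: t => [|t /step_ex[y /= -> //]].
by rewrite /mem/= add0r.
Qed.

Let nested_cell x u t : 0 <= u < 1 -> mem (cell x t) u -> nested u t = cell x t.
Proof.
move=> u01; elim: t => [//|t ih /= h].
have [_ b _] := cell_bnd x t.
have ct := sub_mem h b.
by rewrite ih//; exact: stepP.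
Qed.

Let cell_mem x u t : 0 <= u < 1 -> x 0%N = s0 ->
  (forall i, (i <= t)%N -> (nested u i).1.1 = x i) <-> mem (cell x t) u.
Proof.
move=> u01 x0; split; last first.
  elim: t => [h [|//] _ /=|t ih h i]; first by rewrite x0.
  rewrite leq_eqVlt => /orP[/eqP ->|].
    by rewrite (nested_cell u01 h) cell1.
  rewrite ltnS; apply: ih; have [_ b _] := cell_bnd x t; exact: sub_mem h b.
elim: t => [_|t ih h]; first by rewrite /mem/= add0r.
have /ih m : forall i, (i <= t)%N -> (nested u i).1.1 = x i.
  by move=> i it; exact: (h i (leqW it)).
have := h t.+1 (leqnn _) => /=; rewrite (nested_cell u01 m).
by have [y -> ym] := step_ex m => /= <-.
Qed.

Definition nested_chain (t : nat) (u : measurableTypeR R) : S :=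
  if 0 <= u < 1 then (nested u t).1.1 else s0.

Let chainE t (x : nat -> S) : x 0%N = s0 ->
  [set w | forall i, (i <= t)%N -> nested_chain i w = x i] `&` unit_itv =
  `[(cell x t).1.2, (cell x t).1.2 + (cell x t).2[%classic.
Proof.
move=> x0; have [a b c] := cell_bnd x t.
apply/seteqP; split => u; rewrite /unit_itv /= !in_itv /=.
  move=> [h u01]; apply/(cell_mem t u01 x0) => i it; rewrite -h//.
  by rewrite /nested_chain u01.
move=> m; have u01 : 0 <= u < 1.
  by case/andP: m => m1 m2; rewrite (le_trans a m1) (lt_le_trans m2 c).
by split => // i it; rewrite /nested_chain u01; exact: (cell_mem t u01 x0).2.
Qed.

Let chain_prob_path t (x : nat -> S) : x 0%N = s0 ->
  unit_measure [set w | forall i, (i <= t)%N -> nested_chain i w = x i] =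
  (cell x t).2%:E.
Proof.
move=> x0; rewrite /unit_measure /mrestr chainE// lebesgue_measure_itv /=.
have [_ b _] := cell_bnd x t.
rewrite lte_fin ltrDl lt_neqAle b andbT; case: eqVneq => [<-//|_] /=.
by rewrite -EFinD addrAC subrr add0r.
Qed.

Let nested_chain_meas t s : measurable [set w | nested_chain t w = s].
Proof.
pose x (f : {ffun 'I_t.+1 -> S}) (i : nat) := f (inord i).
pose D := [set f : {ffun 'I_t.+1 -> S} | x f 0%N = s0 /\ x f t = s].
have -> : [set w | nested_chain t w = s] =
    (\bigcup_(f in D) `[(cell (x f) t).1.2,
       (cell (x f) t).1.2 + (cell (x f) t).2[%classic) `|`
    (~` unit_itv `&` (if s == s0 then setT else set0)).
  apply/seteqP; split => u /=.
    move=> us; have [u01|u01] := boolP (0 <= u < 1); last first.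
      right; split; first by rewrite /unit_itv /= in_itv /=; exact/negP.
      by move: us; rewrite /nested_chain (negbTE u01) => <-; rewrite eqxx.
    left; pose f := [ffun i : 'I_t.+1 => nested_chain i u].
    have xf i : (i <= t)%N -> nested_chain i u = x f i.
      by move=> it; rewrite /x ffunE inordK.
    have x0 : x f 0%N = s0 by rewrite -xf// /nested_chain u01.
    exists f; first by split => //; rewrite -xf.
    by rewrite -chainE//; split => //=; rewrite /unit_itv /= in_itv.
  case=> [[f [x0 xt]]|[]].
    by rewrite -chainE// => -[h _]; rewrite -xt; exact: h.
  rewrite /unit_itv /= in_itv /= => /negP u01.
  by case: eqVneq => // -> _; rewrite /nested_chain (negbTE u01).
apply: measurableU.
  by apply: fin_bigcup_measurable => // f _; exact: measurable_itv.
apply: measurableI; first exact: measurableC.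
by case: ifP.
Qed.

Lemma markov_chain_exists : inhabited (markov_chain K s0).
Proof.
constructor; apply: (@MarkovChain _ _ _ _ _ _ unit_measure nested_chain).
have c0 w : nested_chain 0 w = s0 by rewrite /nested_chain; case: ifP.
split; first exact: nested_chain_meas.
- rewrite -[RHS]unit_measureT; congr (unit_measure _).
  by apply/seteqP; split => // w _ /=.
- move=> t x; have [x0|x0] := eqVneq (x 0%N) s0.
    transitivity (cell x t.+1).2%:E; first exact: chain_prob_path.
    rewrite /= EFinM cell1//; congr (_ * _)%E.
    exact/esym/chain_prob_path.
  have e k : [set w | forall i, (i <= k)%N -> nested_chain i w = x i] = set0.
    apply/seteqP; split => // w /= /(_ 0%N (leq0n _)).
    by rewrite c0 => /esym/eqP; rewrite (negbTE x0).
  by rewrite !e measure0 mul0e.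
Qed.

End existence.

Lemma zero_temp_dynamics_exists (R : realType) (n : nat) (J : couplings n.+1)
    (s0 : config n.+1) : inhabited (zero_temp_dynamics R J s0).
Proof.
have fp0 s i : 0 <= flip_prob R J s i.
  by rewrite mulr_ge0// addr_ge0// mulr_ge0.
have fp1 s i : flip_prob R J s i <= n.+1%:R^-1.
  rewrite ler_piMr//; case: (ltgtP (hamiltonian R J (flip s i))) => _ /=; lra.
have sum1 s : \sum_(i < n.+1) flip_prob R J s i <= 1.
  apply: (le_trans (ler_sum _ (fun i _ => fp1 s i))).
  by rewrite sumr_const card_ord -[leLHS]mulr_natl divff.
have flipN s i : flip s i != s.
  by apply/eqP => /ffunP/(_ i); rewrite ffunE eqxx; case: (s i).
apply: markov_chain_exists => s; rewrite /zero_temp_kernel.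
  by move=> s'; case: ifP => _; [rewrite subr_ge0|exact: sumr_ge0].
rewrite (bigD1 s)//= eqxx.
under [X in _ + X]eq_bigr => s' s's do rewrite (negbTE s's).
rewrite [X in _ + X](exchange_big_dep xpredT)//=.
rewrite [X in _ + X](_ : _ = \sum_(i < n.+1) flip_prob R J s i) ?subrK//.
apply: eq_bigr => i _; rewrite (big_pred1 (flip s i))// => s' /=.
by rewrite andb_idl// => /eqP ->.
Qed.

(* Main.v *)
Require Import Defs.
From mathcomp Require Import all_boot all_order all_algebra.
From mathcomp Require Import all_classical all_reals all_analysis.
From mathcomp Require Import ring lra zify.

Set Implicit Arguments.
Unset Strict Implicit.
Unset Printing Implicit Defensive.

Import Order.TTheory GRing.Theory Num.Theory.
Import numFieldNormedType.Exports.

Local Open Scope classical_set_scope.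
Local Open Scope ring_scope.

(** Write [M] for the magnetization, the sum of the [N] spins.  With probability
    tending to one, the dynamics is absorbed at the constant configuration that
    carries the sign of the initial [M].  Since [|M| >= eps * sqrt N] outside a
    set of initial states of probability of order [eps], the averaged limiting
    spin has absolute value close to 1 for most initial states; this is the
    annealed limit, and the quenched order parameter lies between the annealed
    one and 1 by the Cauchy-Schwarz inequality.

    The law of the chain enters only through the iterates of its kernel
    ([chain_law]): a constant configuration is a trap as soon as no vertex is
    isolated, and the limiting spin is controlled by the probability of not
    being trapped at one fixed time ([E_omega_absorbed]).  The symmetry under a
    global flip reduces the problem to [M > 0].  There, the weight
    [expR (- theta * M)] is a supermartingale as long as the sites with a
    positive local field outnumber the positive spins by a fixed fraction of
    [N] ([kernel_op_drift], [supermartingale_bound]), so everything comes down to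
    counting positive fields along the trajectory.

    At time 0, a field is the difference of two independent binomial variables
    with the same parameters, plus a surplus with mean about [p * M].  The
    difference is symmetric and falls in a window of width comparable to
    [sqrt N] with probability bounded below, so the field is positive with
    probability at least [2^-1 + c] for some fixed [c > 0] ([pair_bias],
    [majority_bias]), and the fraction of sites with this property concentrates
    ([typical_fields]).

    At later times the spins depend on the couplings.  This is overcome by a
    union bound over all states.  For the states that differ from the initial
    one in at most [tau * N] sites, the fields have changed by a small multiple
    of [sqrt N] apart from a systematic part proportional to the change of [M],
    except at a small fraction of the sites; the failure probability is
    [expR (- C * N)] with [C] as large as desired for small [tau], which beats
    the [4 ^ N] choices of a state and of an exceptional set
    ([mixing_uniform]).  Hence the drift persists for [tau * N] steps, which is
    enough for [M] to become macroscopic ([initial_growth]).  From then on, the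
    same union bound shows that almost all fields are positive in every state
    that may be visited, and a lower bound on the degrees takes care of the last
    negative spins ([macroscopic_absorption]). *)

(** * Concentration for functions of independent Bernoulli variables *)

Section exp_bounds.
Context {R : realType}.
Implicit Types x : R.

Lemma expR_le_quadratic x : x <= 2^-1 -> expR x <= 1 + x + 2 * x ^+ 2.
Proof.
move=> x2; have x1 : 0 < 1 - x by lra.
have inv : expR x <= (1 - x)^-1.
  rewrite -[leLHS]invrK lef_pV2 ?posrE ?invr_gt0 ?expR_gt0//.
  by rewrite -expRN; exact: expR_ge1Dx.
apply: (le_trans inv); rewrite -div1r ler_pdivrMr//.
have := sqr_ge0 x; nra.
Qed.

Lemma expRN_le_inv x : 0 < x -> expR (- x) <= x^-1.
Proof.
move=> x0; rewrite expRN lef_pV2 ?posrE ?expR_gt0//.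
by have := expR_ge1Dx x; lra.
Qed.

End exp_bounds.

Section bernoulli_product.
Context {R : realType} (p : R) (E : finType).
Hypothesis p01 : 0 <= p <= 1.

Notation conf := {ffun E -> bool}.
Implicit Types (f g : conf -> R) (J : conf) (e : E) (r : seq E).

Definition Ebern f : R :=
  \sum_(J : conf) (\prod_(e : E) bernoulli_pmf p (J e)) * f J.

Definition Pbern (A : pred conf) : R := Ebern (fun J => (A J)%:R).

Let weight_ge0 J : 0 <= \prod_(e : E) bernoulli_pmf p (J e).
Proof. by apply: prodr_ge0 => e _; exact: bernoulli_pmf_ge0. Qed.

Lemma Ebern_cst c : Ebern (fun=> c) = c.
Proof.
rewrite /Ebern -mulr_suml -(bigA_distr_bigA (fun _ b => bernoulli_pmf p b)).
rewrite big1 ?mul1r// => e _.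
by rewrite big_bool /= /bernoulli_pmf addrC subrK.
Qed.

Lemma le_Ebern f g : (forall J, f J <= g J) -> Ebern f <= Ebern g.
Proof. by move=> fg; apply: ler_sum => J _; apply: ler_wpM2l. Qed.

Lemma eq_Ebern f g : f =1 g -> Ebern f = Ebern g.
Proof. by move=> fg; apply: eq_bigr => J _; rewrite fg. Qed.

Lemma EbernD f g : Ebern (fun J => f J + g J) = Ebern f + Ebern g.
Proof. by rewrite -big_split; apply: eq_bigr => J _; rewrite mulrDr. Qed.

Lemma EbernZ c f : Ebern (fun J => c * f J) = c * Ebern f.
Proof. by rewrite /Ebern mulr_sumr; apply: eq_bigr => J _; rewrite mulrCA. Qed.

Lemma EbernN f : Ebern (fun J => - f J) = - Ebern f.
Proof. by rewrite -mulN1r -EbernZ; apply: eq_Ebern => J; rewrite mulN1r. Qed.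

Lemma Ebern_sum (I : Type) (s : seq I) (P : pred I) (F : I -> conf -> R) :
  Ebern (fun J => \sum_(i <- s | P i) F i J) = \sum_(i <- s | P i) Ebern (F i).
Proof.
rewrite /Ebern exchange_big /=; apply: eq_bigr => J _.
by rewrite mulr_sumr.
Qed.

Lemma Ebern_ge0 f : (forall J, 0 <= f J) -> 0 <= Ebern f.
Proof. by move=> f0; rewrite -(Ebern_cst 0); exact: le_Ebern. Qed.

Lemma le_Pbern (A B : pred conf) : (forall J, A J -> B J) -> Pbern A <= Pbern B.
Proof.
move=> AB; apply: le_Ebern => J; rewrite ler_nat.
by case: (A J) (AB J) => // ->.
Qed.

Lemma PbernC (A : pred conf) : Pbern (fun J => ~~ A J) = 1 - Pbern A.
Proof.
rewrite -{1}(Ebern_cst 1) -EbernN -EbernD; apply: eq_Ebern => J.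
by case: (A J); rewrite ?subrr ?subr0.
Qed.

Lemma PbernU (A B : pred conf) :
  Pbern (fun J => A J || B J) <= Pbern A + Pbern B.
Proof.
rewrite -EbernD; apply: le_Ebern => J.
by case: (A J); case: (B J); rewrite /= ?addr0 ?add0r// lerDl.
Qed.

Lemma Pbern_exists (I : finType) (A : I -> pred conf) c :
  (forall i, Pbern (A i) <= c) ->
  Pbern (fun J => [exists i, A i J]) <= #|I|%:R * c.
Proof.
move=> Ac; apply: (@le_trans _ _ (\sum_(i : I) Pbern (A i))).
  rewrite -Ebern_sum; apply: le_Ebern => J.
  case: existsP => [[i Ai]|_]; last exact: sumr_ge0.
  by rewrite (bigD1 i)//= Ai lerDl sumr_ge0.
rewrite mulr_natl -sumr_const; exact: ler_sum.
Qed.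

Lemma markov_Ebern f a : 0 < a -> (forall J, 0 <= f J) ->
  Pbern (fun J => a <= f J) <= Ebern f / a.
Proof.
move=> a0 f0; rewrite ler_pdivlMr// mulrC -EbernZ; apply: le_Ebern => J.
by case: (leP a (f J)) => h; rewrite ?mulr1 ?mulr0.
Qed.

(** Resampling one coordinate at a time turns every statement about the
    product measure into an induction over a list of coordinates, each step
    of which is a computation with two values. *)
Definition upd J e b : conf := [ffun x => if x == e then b else J x].

Definition resample e f : conf -> R :=
  fun J => p * f (upd J e true) + (1 - p) * f (upd J e false).

Definition resamples r f : conf -> R := foldr resample f r.

Lemma upd_upd J e b b' : upd (upd J e b) e b' = upd J e b'.
Proof. by apply/ffunP => x; rewrite !ffunE; case: (x == e). Qed.

Lemma Ebern_resample e f : Ebern (resample e f) = Ebern f.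
Proof.
(* Group the configurations that differ only at [e]. *)
pose tog J := upd J e (~~ J e).
have togK : involutive tog.
  move=> J; apply/ffunP => x; rewrite !ffunE; case: eqVneq => // ->.
  by rewrite eqxx negbK.
have split2 (F : conf -> R) : \sum_J F J = \sum_(J : conf | J e) (F J + F (tog J)).
  rewrite (bigID (fun J : conf => J e)) /= [RHS]big_split /=; congr (_ + _).
  rewrite (reindex_inj (inv_inj togK)); apply: eq_bigl => J.
  by rewrite ffunE eqxx negbK.
rewrite /Ebern 2!split2; apply: eq_bigr => J Je.
have prodE b : \prod_x bernoulli_pmf p (upd J e b x) =
    bernoulli_pmf p b * \prod_(x | x != e) bernoulli_pmf p (J x).
  rewrite (bigD1 e)//= ffunE eqxx; congr (_ * _).
  by apply: eq_bigr => x xe; rewrite ffunE (negbTE xe).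
have updJ : upd J e true = J.
  by apply/ffunP => x; rewrite ffunE; case: eqVneq => // ->; rewrite Je.
rewrite /resample /tog Je /= !upd_upd updJ prodE.
have := prodE true; rewrite updJ => -> /=.
ring.
Qed.

Lemma Ebern_resamples r f : Ebern (resamples r f) = Ebern f.
Proof. by elim: r => //= e r ih; rewrite Ebern_resample. Qed.

Lemma resamples_indep r f J J' : (forall e, e \notin r -> J e = J' e) ->
  resamples r f J = resamples r f J'.
Proof.
elim: r J J' => [|e r ih] J J' JJ' /=; first by congr f; apply/ffunP => e; exact: JJ'.
by congr (_ * _ + _ * _); apply: ih => x xr; rewrite !ffunE;
  case: eqVneq => // xe; apply: JJ'; rewrite inE negb_or xe.
Qed.

Lemma resamples_enum f J : resamples (enum E) f J = Ebern f.
Proof.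
rewrite -(Ebern_resamples (enum E)) -[LHS]Ebern_cst; apply: eq_Ebern => J'.
by apply: resamples_indep => e; rewrite mem_enum.
Qed.

Definition bounded_diff (c : E -> R) f :=
  forall J e, `|f (upd J e true) - f (upd J e false)| <= c e.

Lemma upd_comm J e e' b b' : e != e' ->
  upd (upd J e b) e' b' = upd (upd J e' b') e b.
Proof.
move=> ee'; apply/ffunP => x; rewrite !ffunE.
by case: (eqVneq x e') => // ->; rewrite eq_sym (negbTE ee').
Qed.

Lemma bounded_diff_resample c e f : bounded_diff c f ->
  bounded_diff c (resample e f).
Proof.
move=> fc J e'; rewrite /resample.
have [<-|ee'] := eqVneq e e'.
  by rewrite !upd_upd subrr normr0 (le_trans _ (fc J e)).
rewrite eq_sym in ee'; rewrite !(upd_comm _ _ _ ee').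
case/andP: p01 => p0 p1.
set a := f _; set b := f _; set a' := f _; set b' := f _.
have h1 : `|a - a'| <= c e' by exact: fc.
have h2 : `|b - b'| <= c e' by exact: fc.
have -> : p * a + (1 - p) * b - (p * a' + (1 - p) * b') =
  p * (a - a') + (1 - p) * (b - b') by ring.
apply: (le_trans (ler_normD _ _)); rewrite !normrM (ger0_norm p0).
rewrite (@ger0_norm _ (1 - p)) ?subr_ge0//.
nra.
Qed.

Lemma bounded_diff_resamples c r f : bounded_diff c f ->
  bounded_diff c (resamples r f).
Proof. by move=> fc; elim: r => //= e r; exact: bounded_diff_resample. Qed.

(** Conditionally on the other coordinates, [f] takes two values, which lie at
    [(1 - p) * d] and [- p * d] from its conditional mean: the first order term
    of the exponential averages to zero. *)
Let exp_resample c e f l J : bounded_diff c f -> 0 <= l -> l * c e <= 2^-1 ->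
  resample e (fun J => expR (l * f J)) J <=
  expR (2 * l ^+ 2 * c e ^+ 2) * expR (l * resample e f J).
Proof.
move=> fc l0 lc; case/andP: p01 => p0 p1.
rewrite /resample; set a := f _; set b := f _.
have ab : `|a - b| <= c e by exact: fc.
set m := p * a + (1 - p) * b.
have ame : a - m = (1 - p) * (a - b) by rewrite /m; ring.
have bme : b - m = - p * (a - b) by rewrite /m; ring.
pose d := l * (a - b).
have dle : `|d| <= 2^-1.
  rewrite normrM ger0_norm//; apply: le_trans lc.
  exact: ler_wpM2l.
have dc : d ^+ 2 <= l ^+ 2 * c e ^+ 2.
  rewrite /d exprMn ler_wpM2l ?sqr_ge0//.
  by rewrite -(real_normK (num_real (a - b))) lerXn2r ?nnegrE// (le_trans _ ab).
have split1 x : expR (l * x) = expR (l * m) * expR (l * (x - m)).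
  by rewrite -expRD; congr expR; ring.
rewrite (split1 a) (split1 b) mulrCA [X in _ + X]mulrCA -mulrDr [leRHS]mulrC.
apply: ler_wpM2l; first exact: expR_ge0.
have da : l * (a - m) = (1 - p) * d by rewrite ame /d; ring.
have db : l * (b - m) = - p * d by rewrite bme /d; ring.
rewrite da db; move: dle; rewrite ler_norml => /andP[d1 d2].
have e1 : expR ((1 - p) * d) <= 1 + (1 - p) * d + 2 * ((1 - p) * d) ^+ 2.
  by apply: expR_le_quadratic; nra.
have e2 : expR (- p * d) <= 1 + (- p * d) + 2 * (- p * d) ^+ 2.
  by apply: expR_le_quadratic; nra.
apply: (@le_trans _ _ (1 + 2 * (l ^+ 2 * c e ^+ 2))); last first.
  by rewrite mulrA; exact: expR_ge1Dx.
apply: (@le_trans _ _ (p * (1 + (1 - p) * d + 2 * ((1 - p) * d) ^+ 2) +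
  (1 - p) * (1 + (- p * d) + 2 * (- p * d) ^+ 2))).
  by apply: lerD; apply: ler_wpM2l; rewrite ?subr_ge0.
have -> : p * (1 + (1 - p) * d + 2 * ((1 - p) * d) ^+ 2) +
  (1 - p) * (1 + (- p * d) + 2 * (- p * d) ^+ 2) =
  1 + 2 * (p * (1 - p) * d ^+ 2) by ring.
rewrite lerD2l ler_wpM2l//; apply: le_trans dc.
rewrite ler_piMl ?sqr_ge0//; nra.
Qed.

(** Resampling the coordinates one after the other keeps the bounds on the
    differences, costs one factor each, and ends with the constant [Ebern f]. *)
Lemma bounded_diff_mgf c f l : bounded_diff c f -> 0 <= l ->
  (forall e, l * c e <= 2^-1) ->
  Ebern (fun J => expR (l * f J)) <=
  expR (2 * l ^+ 2 * \sum_e c e ^+ 2) * expR (l * Ebern f).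
Proof.
move=> fc l0 lc.
suff gen r : Ebern (fun J => expR (l * f J)) <=
    expR (2 * l ^+ 2 * \sum_(e <- r) c e ^+ 2) *
    Ebern (fun J => expR (l * resamples r f J)).
  apply: (le_trans (gen (enum E))).
  rewrite big_enum/=; apply: ler_wpM2l; first exact: expR_ge0.
  under eq_Ebern do rewrite resamples_enum.
  by rewrite Ebern_cst.
elim: r => [|e r ih]; first by rewrite big_nil mulr0 expR0 mul1r.
apply: (le_trans ih); rewrite big_cons mulrDr expRD [leRHS]mulrAC [leRHS]mulrC.
apply: ler_wpM2l; first exact: expR_ge0.
rewrite -EbernZ -(Ebern_resample e); apply: le_Ebern => J.
by apply: exp_resample => //; exact: bounded_diff_resamples.
Qed.

(** McDiarmid's inequality, with constants chosen for a short proof: Chernoff's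
    bound with the parameter [s / (4 C)]. *)
Lemma mcdiarmid c f s C : bounded_diff c f -> 0 < s -> 0 < C ->
  \sum_e c e ^+ 2 <= C -> (forall e, s * c e <= 2 * C) ->
  Pbern (fun J => f J <= Ebern f - s) <= expR (- (s ^+ 2 / (8 * C))).
Proof.
move=> fc s0 C0 cC sc.
pose l := s / (4 * C).
have l0 : 0 < l by rewrite divr_gt0// mulr_gt0.
have Nfc : bounded_diff c (fun J => - f J).
  by move=> J e; rewrite -opprD normrN.
have := @bounded_diff_mgf c (fun J => - f J) l Nfc (ltW l0) _.
have lc e : l * c e <= 2^-1.
  rewrite /l mulrAC ler_pdivrMr ?mulr_gt0//; have := sc e; lra.
move=> /(_ lc) mgf.
pose a := expR (l * (s - Ebern f)).
apply: (@le_trans _ _ (Pbern (fun J => a <= expR (l * - f J)))).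
  apply: le_Pbern => J fJ; rewrite ler_expR ler_wpM2l ?(ltW l0)//; lra.
apply: le_trans (markov_Ebern (expR_gt0 _) (fun J => expR_ge0 _)) _.
rewrite ler_pdivrMr ?expR_gt0//; apply: (le_trans mgf).
rewrite EbernN -!expRD ler_expR.
apply: (@le_trans _ _ (2 * l ^+ 2 * C + l * - Ebern f)).
  by rewrite lerD2r ler_wpM2l// mulr_ge0// sqr_ge0.
rewrite /l le_eqVlt; apply/orP; left; apply/eqP.
field; by rewrite gt_eqF.
Qed.

Definition depends_on (A : {set E}) f :=
  forall J J', {in A, J =1 J'} -> f J = f J'.

Lemma depends_on_resamples (A : {set E}) r f : depends_on A f ->
  depends_on A (resamples r f).
Proof.
move=> fA; elim: r => //= e r ih J J' JJ'; congr (_ * _ + _ * _);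
  by apply: ih => x xA; rewrite !ffunE; case: ifP => // _; exact: JJ'.
Qed.

(** Resampling the coordinates in [A] leaves [g] untouched and turns [f] into
    the constant [Ebern f]. *)
Lemma Ebern_indep (A B : {set E}) f g :
  fintype.disjoint (mem A) (mem B) -> depends_on A f -> depends_on B g ->
  Ebern (fun J => f J * g J) = Ebern f * Ebern g.
Proof.
move=> AB fA gB.
have resg r J : {subset r <= A} ->
    resamples r (fun J => f J * g J) J = resamples r f J * g J.
  move=> rA; elim: r J rA => //= e r ih J rA.
  have eA : e \in A by apply: rA; rewrite mem_head.
  rewrite /resample !ih; try by move=> x xr; apply: rA; rewrite inE xr orbT.
  have gu b : g (upd J e b) = g J.
    apply: gB => x xB; rewrite ffunE; case: eqVneq => // xe.
    by move: (disjointFr AB eA); rewrite -xe xB.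
  by rewrite !gu; ring.
have fcst J : resamples (enum A) f J = Ebern f.
  rewrite -(Ebern_resamples (enum A)) -[LHS]Ebern_cst; apply: eq_Ebern => J'.
  pose J'' : conf := [ffun x => if x \in A then J x else J' x].
  transitivity (resamples (enum A) f J'').
    by apply: depends_on_resamples fA _ _ _ => x xA; rewrite ffunE xA.
  by apply: resamples_indep => x; rewrite mem_enum ffunE => /negbTE ->.
rewrite -(Ebern_resamples (enum A)) -EbernZ; apply: eq_Ebern => J.
by rewrite resg ?fcst// => x; rewrite mem_enum.
Qed.

Lemma Ebern_perm (h : E -> E) f : involutive h ->
  Ebern (fun J => f [ffun e => J (h e)]) = Ebern f.
Proof.
move=> hK; pose H J : conf := [ffun e => J (h e)].
have HK : involutive H by move=> J; apply/ffunP => e; rewrite !ffunE hK.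
rewrite /Ebern [RHS](reindex_inj (inv_inj HK)); apply: eq_bigr => J _.
congr (_ * _); rewrite [LHS](reindex_inj (inv_inj hK)).
by apply: eq_bigr => e _; rewrite ffunE.
Qed.

End bernoulli_product.

Section linear_functions.
Context {R : realType} (p : R) (E : finType).
Hypothesis p01 : 0 <= p <= 1.

Notation conf := {ffun E -> bool}.
Implicit Types (a : E -> R) (J : conf) (e : E) (s V w : R).

Definition lin a J : R := \sum_e a e * (J e)%:R.

Lemma lin_upd_diff a J e : lin a (upd J e true) - lin a (upd J e false) = a e.
Proof.
rewrite /lin -sumrB (bigD1 e)//= big1 ?addr0; last first.
  by move=> x xe; rewrite !ffunE (negbTE xe) subrr.
by rewrite !ffunE eqxx mulr1 mulr0 subr0.
Qed.

Lemma bounded_diff_lin a : bounded_diff (fun e => `|a e|) (lin a).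
Proof. by move=> J e; rewrite lin_upd_diff. Qed.

Lemma Ebern_lin a : Ebern p (lin a) = p * \sum_e a e.
Proof.
rewrite Ebern_sum mulr_sumr; apply: eq_bigr => e _.
rewrite EbernZ mulrC -(Ebern_resample p e) -[in RHS](Ebern_cst p E p).
congr (_ * _); apply: eq_Ebern => J.
by rewrite /resample !ffunE eqxx mulr1 mulr0 addr0.
Qed.

Lemma lin_lower_tail a s V : 0 < s -> 0 < V -> \sum_e a e ^+ 2 <= V ->
  (forall e, s * `|a e| <= 2 * V) ->
  Pbern p (fun J => lin a J <= p * (\sum_e a e) - s) <=
  expR (- (s ^+ 2 / (8 * V))).
Proof.
move=> s0 V0 aV sa; rewrite -Ebern_lin.
apply: (mcdiarmid p01 (bounded_diff_lin a)) => //.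
by under eq_bigr do rewrite real_normK ?num_real//.
Qed.

Lemma lin_upper_tail a s V : 0 < s -> 0 < V -> \sum_e a e ^+ 2 <= V ->
  (forall e, s * `|a e| <= 2 * V) ->
  Pbern p (fun J => p * (\sum_e a e) + s <= lin a J) <=
  expR (- (s ^+ 2 / (8 * V))).
Proof.
move=> s0 V0 aV sa.
have := @lin_lower_tail (fun e => - a e) s V s0 V0 _ _.
under [X in X <= V -> _]eq_bigr do rewrite sqrrN.
move=> /(_ aV) h; apply: le_trans (h _); last by move=> e; rewrite normrN.
apply: le_Pbern => // J; rewrite sumrN mulrN -opprD.
rewrite /lin; under [X in _ -> X <= _]eq_bigr do rewrite mulNr.
by rewrite sumrN lerN2.
Qed.

Definition count (A : {set E}) J : R := lin (fun e => (e \in A)%:R) J.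

Lemma sum_indicator (A : {set E}) : \sum_e ((e \in A)%:R : R) = #|A|%:R.
Proof. by rewrite -sum1_card natr_sum [RHS]big_mkcond; apply: eq_bigr => e _; case: ifP. Qed.

Lemma sum_indicator_sqr (A : {set E}) :
  \sum_e ((e \in A)%:R : R) ^+ 2 = #|A|%:R.
Proof.
by rewrite -sum_indicator; apply: eq_bigr => e _; case: (e \in A);
  rewrite ?expr1n// expr0n.
Qed.

Lemma depends_on_count (A : {set E}) (F : R -> R) :
  depends_on A (fun J => F (count A J)).
Proof.
move=> J J' JJ'; congr F; apply: eq_bigr => e _.
by case: (boolP (e \in A)) => [/JJ' ->//|]; rewrite !mul0r.
Qed.

(** The measure is invariant under such an [h], which makes the counts over [A]
    and over [B] exchangeable. *)
Lemma swap_sets (A B : {set E}) : fintype.disjoint (mem A) (mem B) ->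
  #|A| = #|B| -> exists h : E -> E,
    [/\ involutive h, (forall e, (h e \in A) = (e \in B)) &
        (forall e, (h e \in B) = (e \in A))].
Proof.
move=> AB cAB.
have AnB e : e \in A -> (e \in B) = false by exact: disjointFr.
have BnA e : e \in B -> (e \in A) = false by exact: disjointFl.
pose f (A B : {set E}) e := nth e (enum B) (index e (enum A)).
have fin (A' B' : {set E}) e : #|A'| = #|B'| -> e \in A' -> f A' B' e \in B'.
  move=> c eA; rewrite -mem_enum mem_nth// -cardE -c cardE index_mem.
  by rewrite mem_enum.
have fK (A' B' : {set E}) e : #|A'| = #|B'| -> e \in A' -> f B' A' (f A' B' e) = e.
  move=> c eA.
  have ie : (index e (enum A') < size (enum B'))%N.
    by rewrite -cardE -c cardE index_mem mem_enum.
  rewrite {1}/f {2}/f index_uniq ?enum_uniq//.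
  by rewrite (set_nth_default e) ?nth_index ?mem_enum// index_mem mem_enum.
exists (fun e => if e \in A then f A B e else if e \in B then f B A e else e).
split=> e.
- case: (boolP (e \in A)) => eA.
    have fB := fin A B e cAB eA.
    by rewrite (BnA _ fB) fB fK.
  case: (boolP (e \in B)) => eB; last by rewrite (negbTE eA) (negbTE eB).
  have fA := fin B A e (esym cAB) eB.
  by rewrite fA fK.
- case: (boolP (e \in A)) => eA; first by rewrite (BnA _ (fin A B e cAB eA)) AnB.
  case: (boolP (e \in B)) => eB; last exact: negbTE.
  exact: (fin B A e (esym cAB) eB).
- case: (boolP (e \in A)) => eA; first exact: fin.
  case: (boolP (e \in B)) => eB; last exact: negbTE.
  by rewrite (AnB _ (fin B A e (esym cAB) eB)).
Qed.

Lemma count_perm (h : E -> E) (A B : {set E}) J : involutive h ->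
  (forall e, (h e \in B) = (e \in A)) ->
  count A [ffun e => J (h e)] = count B J.
Proof.
move=> hK hB; rewrite /count /lin [RHS](reindex_inj (inv_inj hK)).
by apply: eq_bigr => e _; rewrite ffunE hB.
Qed.

(** Each of the two tails has probability at most [expR (- 2) <= 4^-1]. *)
Lemma count_concentration (A : {set E}) V : 4 <= V -> #|A|%:R <= V ->
  2^-1 <= Pbern p (fun J => p * #|A|%:R - 4 * Num.sqrt V < count A J <
                           p * #|A|%:R + 4 * Num.sqrt V).
Proof.
move=> V4 AV; have V0 : 0 < V by lra.
set s := 4 * _; have s0 : 0 < s by rewrite mulr_gt0// sqrtr_gt0.
have s2 : s ^+ 2 = 16 * V by rewrite exprMn sqr_sqrtr ?(ltW V0)//; ring.
have q1 : Num.sqrt V <= V / 2.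
  rewrite -[leRHS]ger0_norm ?divr_ge0// ?(ltW V0)// -sqrtr_sqr.
  by apply: ler_wsqrtr; nra.
have sa e : s * `|((e \in A)%:R : R)| <= 2 * V.
  by case: (e \in A); rewrite ?normr1 ?normr0 /s; lra.
have aV : \sum_e ((e \in A)%:R : R) ^+ 2 <= V by rewrite sum_indicator_sqr.
have lo := lin_lower_tail s0 V0 aV sa.
have up := lin_upper_tail s0 V0 aV sa.
have bd : expR (- (s ^+ 2 / (8 * V))) <= 4^-1 :> R.
  have -> : - (s ^+ 2 / (8 * V)) = (-1) + (-1).
    by rewrite s2; field; rewrite gt_eqF.
  rewrite expRD; have := @expRN_le_inv R 2^-1 _.
  have e1 : expR (-1) <= 2^-1 :> R.
    rewrite expRN lef_pV2 ?posrE ?expR_gt0//; have := expR_ge1Dx (1 : R); lra.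
  by have := expR_ge0 (-1 : R); nra.
rewrite sum_indicator in lo up.
have := PbernC p (fun J => p * #|A|%:R - s < count A J < p * #|A|%:R + s).
set P := Pbern _ _; set P' := Pbern _ _ => PP'.
suff : P <= 4^-1 + 4^-1 by rewrite PP'; lra.
apply: (@le_trans _ _ (Pbern p (fun J => (count A J <= p * #|A|%:R - s) ||
   (p * #|A|%:R + s <= count A J)))).
  by apply: le_Pbern => // J; rewrite negb_and -!leNgt.
by apply: (le_trans (PbernU p01 _ _)); apply: lerD; [move: lo|move: up];
  rewrite /count; lra.
Qed.

(** If [m] cells carry half of the law of a variable, then two independent copies
    of it fall in a common cell with probability at least [(4 * m ^ 2)^-1];
    symmetry turns this proximity into a bias above 1/2. *)
Lemma pair_bias (A B : {set E}) V w (m : nat) :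
  fintype.disjoint (mem A) (mem B) -> #|A| = #|B| -> 4 <= V -> #|A|%:R <= V ->
  (0 < m)%N -> 8 * Num.sqrt V <= m%:R * w ->
  2^-1 + (8 * m%:R ^+ 2)^-1 <= Pbern p (fun J => - w < count A J - count B J).
Proof.
move=> AB cAB V4 AV m0 mw.
have mR : 0 < m%:R :> R by rewrite ltr0n.
have w0 : 0 < w.
  rewrite -(pmulr_rgt0 _ mR); apply: lt_le_trans mw.
  by rewrite mulr_gt0// sqrtr_gt0; lra.
have [h [hK hA hB]] := swap_sets AB cAB.
pose lo := p * #|A|%:R - 4 * Num.sqrt V.
pose I (i : 'I_m) (x : R) := lo + i%:R * w <= x < lo + i.+1%:R * w.
pose Q i := Pbern p (fun J => I i (count A J)).
have QB i : Pbern p (fun J => I i (count B J)) = Q i.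
  rewrite /Q /Pbern -(Ebern_perm _ _ hK); apply: eq_Ebern => J.
  by rewrite (@count_perm h B A).
(* The [m] cells [I i] cover the window of the previous lemma; take the most
   likely one. *)
have [i Qi] : exists i, (2 * m%:R)^-1 <= Q i.
  case: (@arg_maxP _ _ _ (Ordinal m0) xpredT Q isT) => i _ iP.
  exists i; rewrite invfM ler_pdivrMr// mulrC.
  apply: (le_trans (count_concentration V4 AV)).
  rewrite -[in leRHS](card_ord m).
  apply: le_trans (Pbern_exists p01 (fun j => iP j isT)).
  apply: le_Pbern => // J /andP[x1 x2]; apply/existsP.
  set x := count A J in x1 x2 *.
  have y0 : 0 <= (x - lo) / w by rewrite divr_ge0 ?(ltW w0)// subr_ge0 ltW.
  have /andP[t1 t2] := truncn_itv y0.
  have tm : (Num.truncn ((x - lo) / w) < m)%N.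
    rewrite -(ltr_nat R); apply: (le_lt_trans t1).
    rewrite ltr_pdivrMr//; apply: lt_le_trans mw; rewrite /lo; lra.
  exists (Ordinal tm); rewrite /I /=.
  move: t1 t2; rewrite ler_pdivlMr// ltr_pdivrMr// => t1 t2.
  by apply/andP; split; lra.
pose W J := count A J - count B J.
have close : (4 * m%:R ^+ 2)^-1 <= Pbern p (fun J => `|W J| < w).
  apply: (@le_trans _ _ (Q i * Q i)).
    have -> : (4 * m%:R ^+ 2)^-1 = (2 * m%:R)^-1 * (2 * m%:R)^-1 :> R.
      by field; rewrite gt_eqF.
    by apply: ler_pM => //; rewrite invr_ge0 mulr_ge0// ltW.
  rewrite -{2}QB /Q /Pbern -(@Ebern_indep _ p _ A B)//; first last.
  - exact: (depends_on_count (fun x => (I i x)%:R)).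
  - exact: (depends_on_count (fun x => (I i x)%:R)).
  apply: le_Ebern => // J; rewrite -natrM mulnb ler_nat /I.
  case: (boolP (_ && _)) => // /andP[/andP[a1 a2] /andP[b1 b2]].
  suff -> : `|W J| < w by [].
  by rewrite -natr1 mulrDl mul1r in a2 b2; rewrite /W ltr_norml; apply/andP; split; lra.
have sym : Pbern p (fun J => W J < w) = Pbern p (fun J => - w < W J).
  rewrite /Pbern -(Ebern_perm _ _ hK); apply: eq_Ebern => J.
  rewrite /W (@count_perm h A B)// (@count_perm h B A)//.
  by rewrite -(opprB (count A J)) ltrNl.
(* The events [- w < W] and [W < w] are equally likely and cover everything;
   their intersection is [`|W| < w]. *)
suff : 1 + Pbern p (fun J => `|W J| < w) =
    Pbern p (fun J => - w < W J) + Pbern p (fun J => - w < W J).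
  have -> : (8 * m%:R ^+ 2)^-1 = (4 * m%:R ^+ 2)^-1 / 2 :> R.
    by field; rewrite gt_eqF.
  by rewrite /W in close *; lra.
rewrite -{2}sym -(Ebern_cst p E 1) -!EbernD; apply: eq_Ebern => J.
rewrite ltr_norml; case: (ltP (- w) (W J)) => h1; case: (ltP (W J) w) => h2 //=.
- by rewrite addrC.
- by have := le_trans h2 h1; rewrite leNgt (lt_trans _ w0)// oppr_lt0.
Qed.

Lemma subset_of_card (A : {set E}) k : (k <= #|A|)%N ->
  exists2 B : {set E}, B \subset A & #|B| = k.
Proof.
move=> kA; exists [set x in take k (enum A)]%SET.
  by apply/fintype.subsetP => x; rewrite inE => /mem_take; rewrite mem_enum.
rewrite cardsE (card_uniqP _) ?take_uniq ?enum_uniq// size_take -cardE.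
by case: ltngtP kA.
Qed.

(** The surplus [#|A| - #|B|] shifts the symmetric difference of the pair
    treated above by an amount that concentrates. *)
Lemma majority_bias (A B : {set E}) V d (m : nat) : 0 < p ->
  fintype.disjoint (mem A) (mem B) -> 0 < d -> d <= #|A|%:R - #|B|%:R ->
  4 <= V -> #|A|%:R <= V -> (0 < m)%N -> 8 * Num.sqrt V <= m%:R * (p * d / 4) ->
  2^-1 + (8 * m%:R ^+ 2)^-1 - expR (- (p ^+ 2 * d / 32)) <=
  Pbern p (fun J => p * d / 4 <= count A J - count B J).
Proof.
move=> p0 AB d0 dAB V4 AV m0 mw.
have BA : (#|B| <= #|A|)%N by rewrite -(ler_nat R); lra.
have [A1 A1A cA1] := subset_of_card BA.
pose C := (A :\: A1)%SET.
have cC : #|C|%:R = #|A|%:R - #|B|%:R :> R.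
  by rewrite cardsDS// cA1 natrB.
have countC J : count A J = count A1 J + count C J.
  rewrite /count /lin -big_split; apply: eq_bigr => e _ /=.
  rewrite finset.in_setD -mulrDl -natrD; congr (_%:R * _).
  by case: (boolP (e \in A1)) => [/(fintype.subsetP A1A) ->|].
have A1B : fintype.disjoint (mem A1) (mem B).
  exact: disjointWl A1A AB.
have A1V : #|A1|%:R <= V by rewrite cA1; apply: le_trans AV; rewrite ler_nat.
have pb := pair_bias A1B cA1 V4 A1V m0 mw.
have C0 : 0 < #|C|%:R :> R by rewrite cC; lra.
have p1 : p <= 1 by case/andP: p01.
have tail : Pbern p (fun J => count C J <= p * #|C|%:R - p * #|C|%:R / 2) <=
    expR (- (p ^+ 2 * d / 32)).
  have s0 : 0 < p * #|C|%:R / 2 by rewrite divr_gt0// mulr_gt0.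
  have aV : \sum_e ((e \in C)%:R : R) ^+ 2 <= #|C|%:R by rewrite sum_indicator_sqr.
  have sa e : p * #|C|%:R / 2 * `|((e \in C)%:R : R)| <= 2 * #|C|%:R.
    by case: (e \in C); rewrite ?normr1 ?normr0; nra.
  have := lin_lower_tail s0 C0 aV sa; rewrite sum_indicator => /le_trans; apply.
  rewrite ler_expR lerN2.
  have -> : (p * #|C|%:R / 2) ^+ 2 / (8 * #|C|%:R) = p ^+ 2 * #|C|%:R / 32.
    by field; rewrite gt_eqF.
  by rewrite ler_pM2r// ler_wpM2l ?sqr_ge0// cC.
rewrite lerBlDr; apply: (le_trans pb).
apply: (@le_trans _ _ (Pbern p (fun J => (p * d / 4 <= count A J - count B J) ||
   (count C J <= p * #|C|%:R - p * #|C|%:R / 2)))); last first.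
  by apply: (le_trans (PbernU p01 _ _)); rewrite lerD2l.
apply: le_Pbern => // J hW; rewrite countC.
case: (leP (count C J) _) => hC; first by rewrite orbT.
rewrite orbF; have : p * d <= p * #|C|%:R by rewrite ler_pM2l// cC.
by move: hW hC; lra.
Qed.

End linear_functions.

(** * Local fields in a random graph *)

Section fields.
Context {R : realType} (N : nat).
Implicit Types (v : 'I_N -> R) (J : couplings N) (i k : 'I_N) (B : {set 'I_N}).
Implicit Types (s : config N).

Definition incidence v i (e : edge N) : R :=
  ((val e).1 == i)%:R * v (val e).2 + ((val e).2 == i)%:R * v (val e).1.

(** A linear form in the couplings, so that the tail bounds for linear forms
    apply to it and to its sums over sites. *)
Definition field J v i : R := lin (incidence v i) J.

Lemma edge_neq (e : edge N) : (val e).1 != (val e).2.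
Proof. by case: e => /= e; rewrite neq_ltn => ->. Qed.

(** Double counting: an edge stands for the two ordered pairs of its ends. *)
Lemma sum_edges (g : 'I_N -> 'I_N -> R) :
  \sum_(e : edge N) (g (val e).1 (val e).2 + g (val e).2 (val e).1) =
  \sum_a \sum_(b | b != a) g a b.
Proof.
have sumval (F : 'I_N * 'I_N -> R) :
    \sum_(e : edge N) F (val e) = \sum_(x : 'I_N * 'I_N | (x.1 < x.2)%N) F x.
  rewrite [RHS](reindex_omap (val : edge N -> _) insub) /=; last first.
    by move=> x xP; rewrite insubT.
  by apply: eq_bigl => e; rewrite valK eqxx (valP e).
rewrite (sumval (fun x => g x.1 x.2 + g x.2 x.1)) big_split /=.
rewrite pair_big_dep /= [RHS](bigID (fun x : 'I_N * 'I_N => (x.1 < x.2)%N)) /=.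
congr (_ + _).
  by apply: eq_bigl => x; rewrite neq_ltn orbC; case: (x.1 < x.2)%N; rewrite ?andbF.
have swapK : involutive (fun x : 'I_N * 'I_N => (x.2, x.1)) by case.
rewrite (reindex_inj (inv_inj swapK)) /=.
apply: eq_bigl => -[a b] /=; rewrite -leqNgt -(inj_eq val_inj) neq_ltn /=.
by case: ltngtP.
Qed.

Lemma sum_incidence v i : \sum_e incidence v i e = \sum_k v k - v i.
Proof.
rewrite (sum_edges (fun a b => (a == i)%:R * v b)).
rewrite (bigD1 i)//= [X in _ + X]big1 ?addr0; last first.
  by move=> a /negbTE ->; rewrite big1// => b _; rewrite mul0r.
rewrite [in RHS](bigD1 i)//= [RHS]addrAC subrr add0r.
by apply: eq_bigr => b _; rewrite eqxx mul1r.
Qed.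

Lemma incidence_sign s i e :
  incidence (spin R s) i e = (incidence (spin R s) i e == 1)%:R -
                             (incidence (spin R s) i e == -1)%:R.
Proof.
have n1 : (1 == -1 :> R) = false.
  by apply/negbTE; rewrite -subr_eq0 opprK paddr_eq0// oner_eq0.
rewrite /incidence /spin; have := edge_neq e.
case: (eqVneq (val e).1 i) => [->|_]; case: (eqVneq (val e).2 i) => [->|_];
  rewrite ?eqxx// => _;
  rewrite ?mul1r ?mul0r ?addr0 ?add0r.
- by case: (s _); rewrite ?eqxx ?n1 ?[-1 == 1]eq_sym ?n1 ?mulr0n ?mulr1n ?subr0 ?sub0r.
- by case: (s _); rewrite ?eqxx ?n1 ?[-1 == 1]eq_sym ?n1 ?mulr0n ?mulr1n ?subr0 ?sub0r.
- by rewrite ![0 == _]eq_sym oppr_eq0 oner_eq0 mulr0n subrr.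
Qed.

Lemma incidence_spin_sqr s i e :
  incidence (spin R s) i e ^+ 2 = incidence (fun=> 1) i e.
Proof.
rewrite /incidence /spin; have := edge_neq e.
case: (eqVneq (val e).1 i) => [->|_]; case: (eqVneq (val e).2 i) => [->|_];
  rewrite ?eqxx// => _;
  rewrite ?mul1r ?mul0r ?addr0 ?add0r ?expr0n//;
  by case: (s _); rewrite ?sqrrN expr1n.
Qed.

Lemma normr_incidence v i e : `|incidence v i e| <= incidence (fun k => `|v k|) i e.
Proof.
apply: (le_trans (ler_normD _ _)); rewrite !normrM.
by rewrite !(@ger0_norm R _%:R).
Qed.

Lemma normr_field J v i : `|field J v i| <= \sum_k `|v k|.
Proof.
apply: (@le_trans _ _ (\sum_e incidence (fun k => `|v k|) i e)); last first.
  by rewrite sum_incidence gerBl.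
apply: (le_trans (ler_norm_sum _ _ _)); apply: ler_sum => e _.
apply: le_trans (normr_incidence v i e).
by rewrite normrM ler_piMr//; case: (J e); rewrite ?normr1 ?normr0.
Qed.

Lemma fieldD J v w i : field J (fun k => v k + w k) i = field J v i + field J w i.
Proof.
rewrite /field /lin -big_split; apply: eq_bigr => e _ /=.
by rewrite /incidence; ring.
Qed.

Lemma fieldN J v i : field J (fun k => - v k) i = - field J v i.
Proof.
rewrite /field /lin -sumrN; apply: eq_bigr => e _ /=.
by rewrite /incidence; ring.
Qed.

Lemma sum_incidence_sites v B e : \sum_(i in B) incidence v i e =
  ((val e).1 \in B)%:R * v (val e).2 + ((val e).2 \in B)%:R * v (val e).1.
Proof.
have pick1 (a : 'I_N) (y : R) : \sum_(i in B) (a == i)%:R * y = (a \in B)%:R * y.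
  rewrite -mulr_suml; congr (_ * _); case: (boolP (a \in B)) => aB.
    rewrite (bigD1 a)//= eqxx big1 ?addr0// => i /andP[_].
    by rewrite eq_sym => /negbTE ->.
  by rewrite big1// => i iB; case: eqVneq => // ai; rewrite ai iB in aB.
by rewrite big_split /= !pick1.
Qed.

Lemma sum_field J v B : \sum_(i in B) field J v i =
  lin (fun e => \sum_(i in B) incidence v i e) J.
Proof.
rewrite /field /lin exchange_big /=; apply: eq_bigr => e _.
by rewrite mulr_suml.
Qed.

End fields.

Section mixing.
Context {R : realType} (p : R) (N : nat).
Hypothesis p01 : 0 <= p <= 1.
Implicit Types (v : 'I_N -> R) (J : couplings N) (i k : 'I_N) (B : {set 'I_N}).
Implicit Types (s : config N) (V L beta : R).

(** In the sum of the fields over [B], an edge has at most two contributions, so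
    the squares of its coefficients sum to at most [2 * #|B| * V]. *)
Lemma mixing v B V L : (0 < #|B|)%N -> (forall k, `|v k| <= 2) ->
  \sum_k v k ^+ 2 <= V -> 0 < L -> L <= V ->
  Pbern p (fun J => \sum_(i in B) field J v i <=
     p * (\sum_(i in B) (\sum_k v k - v i)) - L * #|B|%:R) <=
  expR (- (L ^+ 2 * #|B|%:R / (16 * V))).
Proof.
move=> B0 v2 vV L0 LV; have V0 : 0 < V by exact: lt_le_trans LV.
have B0R : 0 < #|B|%:R :> R by rewrite ltr0n.
pose a e : R := \sum_(i in B) incidence v i e.
have s0 : 0 < L * #|B|%:R by exact: mulr_gt0.
have C0 : 0 < 2 * #|B|%:R * V by rewrite !mulr_gt0.
have mean : \sum_e a e = \sum_(i in B) (\sum_k v k - v i).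
  by rewrite /a exchange_big /=; apply: eq_bigr => i _; rewrite sum_incidence.
have aC : \sum_e a e ^+ 2 <= 2 * #|B|%:R * V.
  pose g (x y : 'I_N) : R := 2 * ((x \in B)%:R * v y ^+ 2).
  apply: (@le_trans _ _ (\sum_(e : edge N)
      (g (val e).1 (val e).2 + g (val e).2 (val e).1))).
    apply: ler_sum => e _; rewrite /a sum_incidence_sites /g.
    set x := v _; set y := v _.
    case: (_ \in B); case: (_ \in B);
      rewrite ?mul1r ?mul0r ?add0r ?addr0 ?expr0n /=; last by rewrite mulr0 addr0.
    - by have := sqr_ge0 (x - y); rewrite sqrrB sqrrD; nra.
    - by have := sqr_ge0 x; nra.
    - by have := sqr_ge0 y; nra.
  rewrite sum_edges.
  apply: (@le_trans _ _ (\sum_(x : 'I_N) (x \in B)%:R * (2 * V))).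
    apply: ler_sum => x _; rewrite /g -!mulr_sumr mulrCA ler_wpM2l// ler_wpM2l//.
    apply: le_trans vV; rewrite [leRHS](bigD1 x)//= lerDr; exact: sqr_ge0.
  rewrite -mulr_suml (_ : \sum_(x : 'I_N) (x \in B)%:R = #|B|%:R :> R); last first.
    rewrite -sum1_card natr_sum [RHS]big_mkcond; apply: eq_bigr => x _.
    by case: ifP.
  by rewrite mulrCA mulrA.
have sa e : L * #|B|%:R * `|a e| <= 2 * (2 * #|B|%:R * V).
  have a4 : `|a e| <= 4.
    rewrite /a sum_incidence_sites; apply: (le_trans (ler_normD _ _)).
    have h (b : bool) k : `|b%:R * v k| <= 2.
      by rewrite normrM; case: b; rewrite ?normr1 ?normr0 ?mul1r ?mul0r.
    by have := lerD (h ((val e).1 \in B) (val e).2) (h ((val e).2 \in B) (val e).1); lra.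
  have -> : 2 * (2 * #|B|%:R * V) = V * #|B|%:R * 4 by ring.
  apply: ler_pM => //; first exact: ltW.
  by rewrite ler_pM2r.
have := lin_lower_tail p01 s0 C0 aC sa; rewrite mean.
have -> : (L * #|B|%:R) ^+ 2 / (8 * (2 * #|B|%:R * V)) = L ^+ 2 * #|B|%:R / (16 * V).
  by field; rewrite !gt_eqF.
by apply: le_trans; apply: le_Pbern => // J; rewrite sum_field.
Qed.

(** The entropy [#|I| * 2 ^ N] of the choice of a vector and of an exceptional
    set is beaten by a probability exponentially small in the size of that
    set; so the vector may be chosen as a function of the couplings. *)
Lemma mixing_uniform (I : finType) (Q : pred I) (v : I -> 'I_N -> R) V L beta :
  (0 < N)%N -> 0 < beta -> 0 < L -> L <= V ->
  (forall x, Q x -> (forall k, `|v x k| <= 2) /\ \sum_k v x k ^+ 2 <= V) ->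
  Pbern p (fun J => [exists x, Q x && (beta * N%:R <=
     #|[set i | field J (v x) i <= p * (\sum_k v x k - v x i) - L]%SET|%:R)]) <=
  #|I|%:R * 2 ^+ N * expR (- (L ^+ 2 * (beta * N%:R) / (16 * V))).
Proof.
move=> N0 b0 L0 LV Qv; have V0 : 0 < V by exact: lt_le_trans LV.
pose A (xB : I * {set 'I_N}) J := [&& Q xB.1, beta * N%:R <= #|xB.2|%:R &
  \sum_(i in xB.2) field J (v xB.1) i <=
  p * (\sum_(i in xB.2) (\sum_k v xB.1 k - v xB.1 i)) - L * #|xB.2|%:R].
have cardE : #|{: I * {set 'I_N}}|%:R = #|I|%:R * 2 ^+ N :> R.
  by rewrite card_prod natrM -(cardsT {set 'I_N}) -powersetT card_powerset cardsT card_ord natrX.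
rewrite -cardE; apply: le_trans (Pbern_exists p01 (A := A) _); last first.
  move=> [x B]; rewrite /A /=.
  case: (boolP (Q x)) => [/Qv[v2 vV]|_] /=; last first.
    by rewrite /Pbern Ebern_cst expR_ge0.
  case: (leP (beta * N%:R) _) => /= [bB|_]; last by rewrite /Pbern Ebern_cst expR_ge0.
  have BR : 0 < #|B|%:R :> R by apply: lt_le_trans bB; rewrite mulr_gt0// ltr0n.
  apply: (le_trans (mixing _ v2 vV L0 LV)); first by rewrite -(ltr0n R).
  rewrite ler_expR lerN2 ler_pM2r ?invr_gt0 ?mulr_gt0//.
  by rewrite ler_pM2l ?exprn_gt0.
apply: le_Pbern => // J /existsP[x /andP[Qx bx]]; apply/existsP.
exists (x, [set i | field J (v x) i <= p * (\sum_k v x k - v x i) - L]%SET).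
rewrite /A /= Qx bx /=; set B := [set _ | _]%SET.
rewrite mulr_sumr mulr_natr -sumr_const -sumrB; apply: ler_sum => i.
by rewrite inE.
Qed.

Let clamp (u : R) : R := if u <= 0 then 0 else if 1 <= u then 1 else u.

Let clamp_lip u w : `|clamp u - clamp w| <= `|u - w|.
Proof.
have l1 : u - w <= `|u - w| by exact: ler_norm.
have l2 : w - u <= `|u - w| by rewrite distrC; exact: ler_norm.
rewrite /clamp ler_norml; apply/andP.
by case: (leP u 0) => h1; case: (leP w 0) => h2; case: (leP 1 u) => h3;
  case: (leP 1 w) => h4; split; lra.
Qed.

(** Smoothing the indicator of [x <= field] makes the number of favourable
    sites a function with bounded differences of order [x^-1], to which
    McDiarmid's inequality applies although the fields are correlated. *)
Lemma typical_fields s (d x q : R) (m : nat) : 0 < p ->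
  0 < d -> d + 1 <= \sum_k spin R s k -> 4 <= N%:R :> R -> (0 < m)%N ->
  8 * Num.sqrt N%:R <= m%:R * (p * d / 4) ->
  0 < x -> 2 * x <= p * d / 4 -> 0 < q -> q * x <= 2 * N%:R ->
  Pbern p (fun J => #|[set j | x <= field J (spin R s) j]%SET|%:R <=
     (2^-1 + (8 * m%:R ^+ 2)^-1 - expR (- (p ^+ 2 * d / 32)) - q) * N%:R) <=
  expR (- (q ^+ 2 * x ^+ 2 / 16)).
Proof.
move=> p0 d0 dM N4 m0 mN x0 xd q0 qx.
have N0 : 0 < N%:R :> R by lra.
set v := spin R s in dM *.
pose psi y := clamp (y / x - 1).
pose F J : R := \sum_j psi (field J v j).
have psi_ind y : psi y <= (x <= y)%R%:R.
  rewrite /psi /clamp; case: (leP x y) => xy.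
    by case: (leP (y / x - 1) 0) => h1; last case: (leP 1 (y / x - 1)) => h2;
      rewrite ?ler01// ltW.
  have : y / x < 1 by rewrite ltr_pdivrMr// mul1r.
  by move=> h; rewrite ifT//; lra.
have ind_psi y : (p * d / 4 <= y)%R%:R <= psi y.
  rewrite /psi /clamp; case: (leP (p * d / 4) y) => xy.
    have h : 2 <= y / x by rewrite ler_pdivlMr//; lra.
    by rewrite ifF ?ifT//; [lra|apply/negbTE; rewrite -ltNge; lra].
  by case: (leP (y / x - 1) 0) => h1 //; case: (leP 1 (y / x - 1)) => h2;
    rewrite ?ler01// ltW.
(* The field at [j] counts the present edges from [j] to the positive spins,
   minus those to the negative spins. *)
have site j : 2^-1 + (8 * m%:R ^+ 2)^-1 - expR (- (p ^+ 2 * d / 32)) <=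
    Ebern p (fun J => psi (field J v j)).
  pose A := [set e | incidence v j e == 1]%SET.
  pose B := [set e | incidence v j e == -1]%SET.
  have AB : fintype.disjoint (mem A) (mem B).
    rewrite disjoint_subset; apply/fintype.subsetP => e; rewrite !inE => /eqP ->.
    by rewrite -subr_eq0 opprK paddr_eq0// oner_eq0.
  have incE e : incidence v j e = (e \in A)%:R - (e \in B)%:R.
    by rewrite !inE; exact: incidence_sign.
  have cAB : #|A|%:R - #|B|%:R = \sum_k v k - v j.
    rewrite -sum_incidence -!sum_indicator -sumrB; apply: eq_bigr => e _.
    by rewrite incE.
  have fieldE J : count A J - count B J = field J v j.
    rewrite /count /field /lin -sumrB; apply: eq_bigr => e _.
    by rewrite incE mulrBl.
  have vj : v j <= 1 by rewrite /v /spin; case: (s j); lra.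
  have AN : #|A|%:R <= N%:R :> R.
    apply: (@le_trans _ _ (\sum_e incidence v j e ^+ 2)).
      rewrite -sum_indicator_sqr; apply: ler_sum => e _.
      by rewrite inE; case: eqVneq => [->|_] //=; rewrite expr0n sqr_ge0.
    under eq_bigr do rewrite incidence_spin_sqr.
    by rewrite sum_incidence sumr_const card_ord; lra.
  have dAB : d <= #|A|%:R - #|B|%:R by rewrite cAB; lra.
  apply: (le_trans (majority_bias p01 p0 AB d0 dAB N4 AN m0 mN)).
  by apply: le_Ebern => // J; rewrite fieldE.
have meanF : (2^-1 + (8 * m%:R ^+ 2)^-1 - expR (- (p ^+ 2 * d / 32))) * N%:R <=
    Ebern p F.
  rewrite /F Ebern_sum -[X in _ * X%:R](card_ord N) mulr_natr -sumr_const.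
  exact: ler_sum.
(* An edge affects the fields at its two ends only. *)
have Fdiff : bounded_diff (fun _ : edge N => 2 / x) F.
  move=> J e; rewrite /F -sumrB; apply: (le_trans (ler_norm_sum _ _ _)).
  apply: (@le_trans _ _ (\sum_j (((val e).1 == j)%:R + ((val e).2 == j)%:R) / x)).
    apply: ler_sum => j _; apply: (le_trans (clamp_lip _ _)).
    rewrite opprB addrA subrK -mulrBl /field lin_upd_diff normrM (@ger0_norm _ x^-1) ?invr_ge0 ?(ltW x0)//.
    rewrite ler_pM2r ?invr_gt0//; apply: (le_trans (normr_incidence _ _ _)).
    have nv k : `|v k| = 1 by rewrite /v /spin; case: (s k); rewrite ?normrN normr1.
    by rewrite /incidence !nv !mulr1.
  rewrite -mulr_suml ler_pM2r ?invr_gt0// big_split /=.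
  have one (a : 'I_N) : \sum_j ((a == j)%:R : R) = 1.
    rewrite (bigD1 a)//= eqxx big1 ?addr0// => j.
    by rewrite eq_sym => /negbTE ->.
  by rewrite !one.
have C0 : 0 < 2 * N%:R ^+ 2 / x ^+ 2 by rewrite divr_gt0// ?mulr_gt0// exprn_gt0.
have sumC : \sum_(e : edge N) (2 / x) ^+ 2 <= 2 * N%:R ^+ 2 / x ^+ 2.
  pose g (_ _ : 'I_N) : R := 2 / x ^+ 2.
  have -> : \sum_(e : edge N) (2 / x) ^+ 2 =
      \sum_(e : edge N) (g (val e).1 (val e).2 + g (val e).2 (val e).1).
    by apply: eq_bigr => e _; rewrite /g expr_div_n; field; rewrite gt_eqF.
  rewrite sum_edges; apply: (@le_trans _ _ (\sum_(a : 'I_N) \sum_(b : 'I_N) 2 / x ^+ 2)).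
    apply: ler_sum => a _; rewrite [leRHS](bigD1 a)//= lerDr.
    by rewrite divr_ge0// sqr_ge0.
  by rewrite !sumr_const card_ord -(mulr_natr (2 / x ^+ 2 *+ N) N)
    -(mulr_natr (2 / x ^+ 2) N) le_eqVlt; apply/orP; left; apply/eqP; ring.
have qN0 : 0 < q * N%:R by exact: mulr_gt0.
have cond (e : edge N) : q * N%:R * (2 / x) <= 2 * (2 * N%:R ^+ 2 / x ^+ 2).
  have -> : q * N%:R * (2 / x) = q * x * (2 * N%:R / x ^+ 2) by field; rewrite gt_eqF.
  have -> : 2 * (2 * N%:R ^+ 2 / x ^+ 2) = 2 * N%:R * (2 * N%:R / x ^+ 2) :> R.
    by field; rewrite gt_eqF.
  by rewrite ler_wpM2r// divr_ge0 ?sqr_ge0// mulr_ge0// ltW.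
have := mcdiarmid p01 Fdiff qN0 C0 sumC cond.
have -> : (q * N%:R) ^+ 2 / (8 * (2 * N%:R ^+ 2 / x ^+ 2)) = q ^+ 2 * x ^+ 2 / 16.
  by field; rewrite !gt_eqF.
apply: le_trans; apply: le_Pbern => // J hJ.
rewrite lerBrDr; apply: le_trans (meanF).
rewrite mulrBl lerBrDr in hJ; apply: le_trans hJ; rewrite lerD2r.
rewrite /F -sum1_card natr_sum [leRHS]big_mkcond; apply: ler_sum => j _ /=.
by rewrite inE; apply: (le_trans (psi_ind _)); case: ifP.
Qed.

(** The degree is the field of the constant vector 1; this is [mixing] for the
    sets with one element. *)
Lemma min_degree : 4 <= N%:R :> R -> 0 < p ->
  Pbern p (fun J => [exists i, field J (fun=> 1) i <= p / 2 * N%:R]) <=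
  N%:R * expR (- (p ^+ 2 * N%:R / 256)).
Proof.
move=> N4 p0; have N0 : 0 < N%:R :> R by lra.
have p1 : p <= 1 by case/andP: p01.
have L0 : 0 < p * N%:R / 4 by rewrite divr_gt0 ?mulr_gt0.
have LN : p * N%:R / 4 <= N%:R by nra.
rewrite -[X in X%:R * expR _](card_ord N).
apply: (Pbern_exists p01 (A := fun i J => field J (fun=> 1) i <= p / 2 * N%:R)) => i.
have c0 : (0 < #|[set i]%SET|)%N by rewrite cards1.
have v2 (k : 'I_N) : `|1 : R| <= 2 by rewrite normr1; lra.
have vV : \sum_(k < N) (1 : R) ^+ 2 <= N%:R.
  by rewrite expr1n sumr_const card_ord.
have := mixing c0 v2 vV L0 LN; rewrite cards1 !big_set1 sumr_const card_ord.
have -> : (p * N%:R / 4) ^+ 2 * 1 / (16 * N%:R) = p ^+ 2 * N%:R / 256.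
  by field; rewrite gt_eqF.
apply: le_trans; apply: le_Pbern => // J; rewrite big_set1 => /le_trans; apply.
clear v2 vV; nra.
Qed.

End mixing.

(** * The magnetization under the zero-temperature kernel *)

Section kernel.
Context {R : realType} (N : nat) (J : couplings N).
Implicit Types (s : config N) (i : 'I_N) (g u : config N -> R) (t : nat).

Definition magn s : R := \sum_i spin R s i.

Definition kernel_op g s : R := \sum_s' zero_temp_kernel R J s s' * g s'.

Lemma flip_neq s i : flip s i != s.
Proof. by apply/eqP => /ffunP/(_ i); rewrite ffunE eqxx; case: (s i). Qed.

Lemma kernel_opE g s : kernel_op g s =
  g s + \sum_i flip_prob R J s i * (g (flip s i) - g s).
Proof.
rewrite /kernel_op (bigD1 s)//= {1}/zero_temp_kernel eqxx.
have -> : \sum_(s' | s' != s) zero_temp_kernel R J s s' * g s' =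
    \sum_i flip_prob R J s i * g (flip s i).
  rewrite (eq_bigr (fun s' => \sum_(i < N | s' == flip s i)
     flip_prob R J s i * g s')); last first.
    by move=> s' s's; rewrite /zero_temp_kernel (negbTE s's) mulr_suml.
  rewrite (exchange_big_dep xpredT)//=; apply: eq_bigr => i _.
  rewrite (big_pred1 (flip s i))// => s' /=.
  by rewrite andb_idl// => /eqP ->; exact: flip_neq.
under [in RHS]eq_bigr do rewrite mulrBr.
by rewrite sumrB -mulr_suml mulrBl mul1r; ring.
Qed.

Lemma spin_flip s i k : spin R (flip s i) k =
  if k == i then - spin R s k else spin R s k.
Proof. by rewrite /spin ffunE; case: eqVneq => // _; case: (s k); rewrite ?opprK. Qed.

Lemma spin_sqr s i : spin R s i * spin R s i = 1.
Proof. by rewrite /spin; case: (s i); rewrite ?mulrNN mulr1. Qed.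

Lemma magn_flip s i : magn (flip s i) = magn s - 2 * spin R s i.
Proof.
rewrite /magn (bigD1 i)//= [in RHS](bigD1 i)//= spin_flip eqxx.
rewrite (eq_bigr (spin R s)); first by ring.
by move=> k ki; rewrite spin_flip (negbTE ki).
Qed.

Lemma hamiltonian_flip s i : hamiltonian R J (flip s i) - hamiltonian R J s =
  N%:R^-1 * (2 * (spin R s i * field J (spin R s) i)).
Proof.
rewrite /hamiltonian -mulrBr mulNr -mulrN opprB -sumrB.
congr (_ * _); rewrite /field /lin !mulr_sumr; apply: eq_bigr => e _.
rewrite !spin_flip /incidence; have := edge_neq e.
case: (eqVneq (val e).1 i) => [->|_]; case: (eqVneq (val e).2 i) => [->|_];
  rewrite ?eqxx// => _; rewrite ?mul1r ?mul0r ?add0r ?addr0; ring.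
Qed.

Hypothesis N0 : (0 < N)%N.

Let NR : 0 < N%:R^-1 :> R. Proof. by rewrite invr_gt0 ltr0n. Qed.

Lemma flip_probE s i : flip_prob R J s i = N%:R^-1 *
  ((spin R s i * field J (spin R s) i < 0)%R%:R +
   2^-1 * (spin R s i * field J (spin R s) i == 0)%:R).
Proof.
rewrite /flip_prob -subr_lt0 -subr_eq0 hamiltonian_flip.
by rewrite pmulr_rlt0// pmulr_rlt0// !mulf_eq0 gt_eqF// pnatr_eq0.
Qed.

Lemma flip_prob_ge0 s i : 0 <= flip_prob R J s i.
Proof. by rewrite flip_probE mulr_ge0 ?(ltW NR)// addr_ge0// mulr_ge0. Qed.

Lemma flip_prob_le s i : flip_prob R J s i <= N%:R^-1.
Proof.
rewrite flip_probE ler_piMr// ?(ltW NR)//.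
by case: (ltgtP (spin R s i * _) 0) => _ /=; lra.
Qed.

Lemma sum_flip_prob s : \sum_i flip_prob R J s i <= 1.
Proof.
apply: (le_trans (ler_sum _ (fun i _ => flip_prob_le s i))).
by rewrite sumr_const card_ord -[leLHS]mulr_natl divff// pnatr_eq0 -lt0n.
Qed.

Lemma flip_prob_aligned s i : 0 < spin R s i * field J (spin R s) i ->
  flip_prob R J s i = 0.
Proof. by move=> h; rewrite flip_probE ltNge ltW//= gt_eqF// mulr0 addr0 mulr0. Qed.

Lemma flip_prob_opposed s i : spin R s i * field J (spin R s) i < 0 ->
  flip_prob R J s i = N%:R^-1.
Proof. by move=> h; rewrite flip_probE h lt_eqF// mulr0 addr0 mulr1. Qed.

Lemma le_kernel_op g u s : g s <= u s -> (forall i, g (flip s i) <= u (flip s i)) ->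
  kernel_op g s <= kernel_op u s.
Proof.
move=> gus gu; rewrite !kernel_opE.
have split1 w : w s + \sum_i flip_prob R J s i * (w (flip s i) - w s) =
    (1 - \sum_i flip_prob R J s i) * w s +
    \sum_i flip_prob R J s i * w (flip s i).
  under eq_bigr do rewrite mulrBr.
  by rewrite sumrB -mulr_suml; ring.
rewrite !split1 lerD//; first by rewrite ler_wpM2l// subr_ge0 sum_flip_prob.
by apply: ler_sum => i _; rewrite ler_wpM2l// flip_prob_ge0.
Qed.

Lemma kernel_opZD (a c : R) g s :
  kernel_op (fun x => a * g x + c) s = a * kernel_op g s + c.
Proof.
rewrite !kernel_opE mulrDr mulr_sumr addrAC; congr (_ + _ + _).
by apply: eq_bigr => i _; ring.
Qed.

(** [evolve t u s] is the expectation of [u] at time [t] for the chain started at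
    [s]; unfolding it removes the first step of the chain. *)
Definition evolve t u := iter t kernel_op u.

Lemma evolve_le1 u t s : (forall s, u s <= 1) -> evolve t u s <= 1.
Proof.
move=> u1; elim: t s => [|t ih] s /=; first exact: u1.
apply: (@le_trans _ _ (kernel_op (fun=> 0 * 0 + 1) s)).
  by apply: le_kernel_op => *; rewrite mul0r add0r; exact: ih.
by rewrite kernel_opZD mul0r add0r.
Qed.

(** A bound by a supermartingale: [phi] contracts at rate [r] while the chain
    stays in the good region, [A * phi >= 1] where it may leave this region,
    and [B * phi] pays for not having reached the target in time.  The
    predicate [G k] lets the region shrink with the number [k] of steps left. *)
Lemma supermartingale_bound u (phi : config N -> R) (G : nat -> pred (config N))
    (A B r c : R) :
  0 <= A -> 0 <= B -> 0 <= r <= 1 -> 0 <= c -> (forall s, 0 <= phi s) ->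
  (forall s, u s <= 1) ->
  (forall k s i, G k.+1 s -> G k s && G k (flip s i)) ->
  (forall s, G 0 s -> u s <= B * phi s + c) ->
  (forall k s, G k.+1 s -> [\/ 1 <= A * phi s, kernel_op phi s <= r * phi s |
     evolve k.+1 u s <= c]) ->
  forall k s, G k s -> evolve k u s <= (A + r ^+ k * B) * phi s + c.
Proof.
move=> A0 B0 /andP[r0 r1] c0 phi0 u1 GS G0 step; elim=> [|k ih] s Gs.
  rewrite expr0 mul1r; apply: (le_trans (G0 s Gs)).
  by rewrite lerD2r mulrDl lerDr mulr_ge0.
have rB0 j : 0 <= r ^+ j * B by rewrite mulr_ge0// exprn_ge0.
case: (step k s Gs) => [h|h|h].
- apply: (le_trans (evolve_le1 _ _ u1)); apply: (le_trans h).
  by rewrite mulrDl -addrA lerDl addr_ge0// mulr_ge0.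
- apply: (@le_trans _ _ (kernel_op (fun x => (A + r ^+ k * B) * phi x + c) s)).
    have Gi i := andP (GS k s i Gs).
    apply: le_kernel_op => [|i]; last by apply: ih; case: (Gi i).
    by apply: ih; case: (Gi (Ordinal N0)).
  rewrite kernel_opZD lerD2r.
  apply: (@le_trans _ _ ((A + r ^+ k * B) * (r * phi s))).
    by rewrite ler_wpM2l// addr_ge0.
  rewrite mulrA ler_wpM2r// mulrDl exprS mulrAC [r * _]mulrC lerD2r.
  by rewrite ler_piMr.
- by apply: (le_trans h); rewrite lerDr mulr_ge0// addr_ge0.
Qed.

Definition expmagn (theta : R) s : R := expR (- (theta * magn s)).

Lemma kernel_op_expmagn theta s : kernel_op (expmagn theta) s =
  expmagn theta s *
  (1 + \sum_i flip_prob R J s i * (expR (2 * theta * spin R s i) - 1)).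
Proof.
rewrite kernel_opE mulrDr mulr1 mulr_sumr; congr (_ + _); apply: eq_bigr => i _.
rewrite mulrCA; congr (_ * _); rewrite /expmagn magn_flip [RHS]mulrBr mulr1 -expRD.
by congr (expR _ - _); ring.
Qed.

Lemma card_plus s : \sum_i ((s i)%:R : R) = (N%:R + magn s) / 2.
Proof.
rewrite -[X in X%:R + _](card_ord N) -sum1_card natr_sum -big_split mulr_suml.
by apply: eq_bigr => i _ /=; rewrite /spin; case: (s i); rewrite /=; lra.
Qed.

(** Flips go downhill: if the sites whose field points up outnumber those
    whose spin does, the magnetization has a positive drift, and so a small
    exponential tilt of it is a strict supermartingale. *)
Lemma kernel_op_drift theta s : 0 <= theta <= 4^-1 ->
  (N%:R + magn s) / 2 + 8 * theta * N%:R <=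
    #|[set i | 0 < field J (spin R s) i]%SET|%:R ->
  kernel_op (expmagn theta) s <= (1 - 8 * theta ^+ 2) * expmagn theta s.
Proof.
move=> /andP[th0 th1] pos.
rewrite kernel_op_expmagn [leRHS]mulrC ler_wpM2l ?expR_ge0// lerD2l.
have quad i : expR (2 * theta * spin R s i) - 1 <=
    2 * theta * spin R s i + 8 * theta ^+ 2.
  have sp : spin R s i <= 1 by rewrite /spin; case: (s i); lra.
  have h : 2 * theta * spin R s i <= 2^-1 by nra.
  have := expR_le_quadratic h.
  have -> : (2 * theta * spin R s i) ^+ 2 = 4 * theta ^+ 2 * (spin R s i * spin R s i).
    by ring.
  by rewrite spin_sqr; lra.
(* A spin aligned with a nonzero field does not flip, and a negative spin in a
   positive field flips as soon as its site is chosen. *)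
have drift i : flip_prob R J s i * spin R s i <=
    N%:R^-1 * ((s i)%:R - (i \in [set i | 0 < field J (spin R s) i]%SET)%:R).
  rewrite inE; have f0 := flip_prob_ge0 s i; have f1 := flip_prob_le s i.
  have al := @flip_prob_aligned s i; have op := @flip_prob_opposed s i.
  move: al op; rewrite /spin; case: (s i) => /=; case: (ltP 0 (field _ _ _)) => h al op.
  - by rewrite al ?mul1r// mul0r subrr mulr0.
  - by rewrite mulr1 subr0 mulr1.
  - by rewrite op ?mulN1r ?oppr_lt0// sub0r.
  - by rewrite subrr mulr0 mulrN1 oppr_le0.
apply: (@le_trans _ _ (2 * theta * (\sum_i flip_prob R J s i * spin R s i) +
   8 * theta ^+ 2 * \sum_i flip_prob R J s i)).
  rewrite !mulr_sumr -big_split; apply: ler_sum => i _ /=.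
  apply: (le_trans (ler_wpM2l (flip_prob_ge0 s i) (quad i))).
  by rewrite le_eqVlt; apply/orP; left; apply/eqP; ring.
have d2 : \sum_i flip_prob R J s i * spin R s i <= - (8 * theta).
  apply: (le_trans (ler_sum _ (fun i _ => drift i))).
  rewrite -mulr_sumr sumrB card_plus sum_indicator.
  have -> : - (8 * theta) = N%:R^-1 * (- (8 * theta * N%:R)) :> R.
    by field; rewrite pnatr_eq0 -lt0n.
  by rewrite ler_pM2l//; lra.
have f1 := sum_flip_prob s.
have h1 : 2 * theta * (\sum_i flip_prob R J s i * spin R s i) <=
   2 * theta * - (8 * theta) by rewrite ler_wpM2l// mulr_ge0.
have h2 : 8 * theta ^+ 2 * (\sum_i flip_prob R J s i) <= 8 * theta ^+ 2 * 1.
  by rewrite ler_wpM2l// mulr_ge0// sqr_ge0.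
apply: (le_trans (lerD h1 h2)); nra.
Qed.

(** When all fields are positive, only negative spins flip. *)
Lemma kernel_op_end theta s i : 0 <= theta <= 8^-1 -> ~~ s i ->
  (forall i, 0 < field J (spin R s) i) ->
  kernel_op (expmagn theta) s <= (1 - theta / N%:R) * expmagn theta s.
Proof.
move=> /andP[th0 th1] si pos.
rewrite kernel_op_expmagn [leRHS]mulrC ler_wpM2l ?expR_ge0// lerD2l.
have ex : expR (- (2 * theta)) - 1 <= - theta.
  have h : - (2 * theta) <= 2^-1 by lra.
  by have := expR_le_quadratic h; rewrite sqrrN; nra.
have term k : flip_prob R J s k * (expR (2 * theta * spin R s k) - 1) <=
    N%:R^-1 * - theta * (~~ s k)%:R.
  have := @flip_prob_aligned s k; have := @flip_prob_opposed s k.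
  rewrite /spin; case: (s k) => op al /=.
    by rewrite al ?mul1r// mul0r mulr0.
  rewrite op ?mulN1r ?oppr_lt0// mulrN1 mulr1.
  by rewrite ler_pM2l.
apply: (le_trans (ler_sum _ (fun k _ => term k))).
rewrite -mulr_sumr -[leRHS]mulr1 [theta / _]mulrC -mulrN; apply: ler_wnM2l.
  by rewrite mulrN oppr_le0 mulr_ge0// ltW.
by rewrite (bigD1 i)//= si lerDl sumr_ge0.
Qed.

Definition negate s : config N := [ffun i => ~~ s i].

Lemma spin_negate s i : spin R (negate s) i = - spin R s i.
Proof. by rewrite /spin ffunE; case: (s i); rewrite ?opprK. Qed.

Lemma magn_negate s : magn (negate s) = - magn s.
Proof. by rewrite /magn -sumrN; apply: eq_bigr => i _; exact: spin_negate. Qed.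

Lemma flip_prob_negate s i : flip_prob R J (negate s) i = flip_prob R J s i.
Proof.
rewrite !flip_probE spin_negate.
have -> : field J (spin R (negate s)) i = - field J (spin R s) i.
  rewrite -fieldN; congr (field J _ i); apply/funext => k.
  exact: spin_negate.
by rewrite mulrNN.
Qed.

Lemma kernel_op_negate g s :
  kernel_op (fun x => g (negate x)) s = kernel_op g (negate s).
Proof.
rewrite !kernel_opE; congr (_ + _); apply: eq_bigr => i _.
have -> : negate (flip s i) = flip (negate s) i.
  by apply/ffunP => k; rewrite !ffunE; case: ifP.
by rewrite flip_prob_negate.
Qed.

Lemma evolve_negate t u s :
  evolve t (fun x => u (negate x)) s = evolve t u (negate s).
Proof.
elim: t s => //= t ih s; rewrite -kernel_op_negate.
by congr (kernel_op _ s); apply/funext => x; exact: ih.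
Qed.

End kernel.

(** * From the Markov chain to the iterates of its kernel *)

Section chain_law.
Context {R : realType} (S : finType) (K : S -> S -> R) (s0 : S).
Variable X : markov_chain K s0.
Implicit Types (t : nat) (y z a : S).

Let P := chain_prob X.
Let T := chain_space X.

Definition Pr (A : set T) : R := fine (P A).

Let measX t y : measurable [set w | X t w = y].
Proof. by have [h _ _] := chainP X; exact: h. Qed.

Let PrE (A : set T) : measurable A -> P A = (Pr A)%:E.
Proof. by move=> mA; rewrite fineK// fin_num_measure. Qed.

Lemma Pr_ge0 (A : set T) : 0 <= Pr A.
Proof. by rewrite /Pr fine_ge0. Qed.

Lemma le_Pr (A B : set T) : measurable A -> measurable B -> A `<=` B ->
  Pr A <= Pr B.
Proof. by move=> mA mB AB; rewrite -lee_fin -!PrE// le_measure ?inE. Qed.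

Let Pr_partition (F : finType) (Y : T -> F) (A : set T) : measurable A ->
  (forall f, measurable [set w | Y w = f]) ->
  Pr A = \sum_(f : F) Pr (A `&` [set w | Y w = f]).
Proof.
move=> mA mY; apply: EFin_inj; rewrite -PrE// -sumEFin.
have AE : A = \bigcup_(f in [set` enum F]) (A `&` [set w | Y w = f]).
  apply/seteqP; split => w; last by case=> f _ [].
  by move=> Aw; exists (Y w) => //=; rewrite mem_enum.
rewrite [in LHS]AE measure_fin_bigcup//; last first.
- by move=> f _; exact: measurableI.
- by move=> f g _ _ [w [[_ <-] [_ <-]]].
rewrite -fsbig_seq ?enum_uniq// big_enum /=; apply: eq_bigr => f _.
by rewrite PrE//; exact: measurableI.
Qed.

(** The law of a chain is given on finite trajectories; sum over those that
    reach [y] at time [t]. *)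
Lemma Pr_step t y z : Pr [set w | X t w = y /\ X t.+1 w = z] =
  Pr [set w | X t w = y] * K y z.
Proof.
pose Y w : {ffun 'I_t.+1 -> S} := [ffun i : 'I_t.+1 => X i w].
pose path (f : {ffun 'I_t.+1 -> S}) (i : nat) := if (i <= t)%N then f (inord i) else z.
have YP f w : Y w = f <-> forall i, (i <= t)%N -> X i w = path f i.
  split => [<- i it|h].
    by rewrite /path it ffunE inordK.
  apply/ffunP => i; have it : (i <= t)%N by rewrite -ltnS.
  by rewrite ffunE h// /path it inord_val.
have mpath k (x : nat -> S) :
    measurable [set w | forall i, (i <= k)%N -> X i w = x i].
  have -> : [set w | forall i, (i <= k)%N -> X i w = x i] =
      \bigcap_(i in [set i | (i <= k)%N]) [set w | X i w = x i] by [].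
  by apply: bigcap_measurable => [|i _]; [exists 0%N|exact: measX].
have mY f : measurable [set w | Y w = f].
  rewrite (_ : [set w | _] = [set w | forall i, (i <= t)%N -> X i w = path f i]) //.
  by apply/seteqP; split => w /= /YP.
have mA : measurable [set w | X t w = y /\ X t.+1 w = z].
  exact: (measurableI _ _ (measX t y) (measX t.+1 z)).
rewrite (Pr_partition mA mY) (Pr_partition (measX t y) mY) mulr_suml.
apply: eq_bigr => f _.
have ft w : Y w = f -> X t w = f ord_max.
  by move=> <-; rewrite ffunE.
have [fy|fy] := eqVneq (f ord_max) y; last first.
  have e0 (A : set T) : (A `<=` [set w | X t w = y]) ->
      Pr (A `&` [set w | Y w = f]) = 0.
    move=> Ay; rewrite (_ : _ `&` _ = set0) /Pr ?measure0//.
    apply/seteqP; split => // w [/Ay /= Aw /ft]; rewrite Aw => /esym/eqP.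
    by rewrite (negbTE fy).
  by rewrite !e0 ?mul0r// => w [].
have [_ _ hP] := chainP X.
have := hP t (path f); rewrite -/P.
have -> : path f t = y by rewrite /path leqnn -fy; congr (f _); apply/val_inj; rewrite /= inordK.
have -> : path f t.+1 = z by rewrite /path ltnn.
have -> : [set w | forall i, (i <= t.+1)%N -> X i w = path f i] =
   [set w | X t w = y /\ X t.+1 w = z] `&` [set w | Y w = f].
  apply/seteqP; split => w /=.
    move=> h; have Yf : Y w = f by apply/YP => i it; apply: h; exact: leqW.
    by rewrite (ft _ Yf) fy h// /path ltnn.
  move=> [[_ hz] /YP h] i; rewrite leq_eqVlt => /orP[/eqP ->|]; last exact: h.
  by rewrite /path ltnn.
have -> : [set w | forall i, (i <= t)%N -> X i w = path f i] =
   [set w | X t w = y] `&` [set w | Y w = f].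
  apply/seteqP; split => w /=.
    by move=> /YP Yf; rewrite (ft _ Yf).
  by move=> [_ /YP].
rewrite [X in X = _ -> _]PrE; last exact: measurableI.
rewrite [X in _ = (X * _)%E -> _]PrE; last exact: measurableI.
by rewrite -EFinM => -[].
Qed.

Definition chain_op (g : S -> R) (x : S) : R := \sum_y K x y * g y.

Lemma chain_law t (g : S -> R) :
  \sum_y Pr [set w | X t w = y] * g y = iter t chain_op g s0.
Proof.
elim: t g => [|t ih] g.
  have [_ h0 _] := chainP X.
  have P0 : Pr [set w | X 0%N w = s0] = 1 by rewrite /Pr /P h0.
  rewrite (bigD1 s0)//= P0 mul1r big1 ?addr0// => y ys0.
  suff -> : Pr [set w | X 0%N w = y] = 0 by rewrite mul0r.
  apply/eqP; rewrite eq_le Pr_ge0 andbT.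
  have mC : measurable (~` [set w | X 0%N w = s0]) by exact: measurableC.
  apply: (@le_trans _ _ (Pr (~` [set w | X 0%N w = s0]))).
    apply: le_Pr => // w /= ->; exact/eqP.
  by rewrite /Pr probability_setC// /P h0 subee.
rewrite iterSr -ih.
have stepE y : Pr [set w | X t.+1 w = y] = \sum_x Pr [set w | X t w = x] * K x y.
  rewrite (Pr_partition (measX t.+1 y) (measX t)); apply: eq_bigr => x _.
  rewrite -Pr_step; congr Pr; apply/seteqP; split => w /= [] //.
under eq_bigr do rewrite stepE mulr_suml.
rewrite exchange_big /=; apply: eq_bigr => x _.
by rewrite mulr_sumr; apply: eq_bigr => y _; rewrite mulrA.
Qed.

Lemma measurable_eventually (b : pred S) :
  measurable [set w | exists t0, forall t, (t0 <= t)%N -> b (X t w)].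
Proof.
have -> : [set w | exists t0, forall t, (t0 <= t)%N -> b (X t w)] =
    \bigcup_t0 \bigcap_(t in [set t | (t0 <= t)%N]) [set w | b (X t w)].
  apply/seteqP; split => w /=; first by move=> [t0 h]; exists t0.
  by move=> [t0 _ h]; exists t0.
apply: bigcupT_measurable => t0; apply: bigcap_measurable; first by exists t0 => /=.
move=> t _; have -> : [set w | b (X t w)] = \bigcup_(y in [set y | b y]) [set w | X t w = y].
  apply/seteqP; split => w /=; first by move=> h; exists (X t w).
  by move=> [y /= by0 ->].
by apply: fin_bigcup_measurable => // y _; exact: measX.
Qed.

(** Leaving the trap [a] at some later time is a countable union of null
    events. *)
Lemma Pr_absorbed t a (b : pred S) : K a a = 1 -> b a ->
  Pr [set w | X t w = a] <=
  Pr [set w | exists t0, forall t, (t0 <= t)%N -> b (X t w)].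
Proof.
move=> Kaa ba; set B := [set w | exists _, _].
pose leave k := [set w | X k w = a] `\` [set w | X k w = a /\ X k.+1 w = a].
have mB : measurable B by exact: measurable_eventually.
have m2 k : measurable [set w | X k w = a /\ X k.+1 w = a].
  exact: (measurableI _ _ (measX k a) (measX k.+1 a)).
have ml k : measurable (leave k) by exact: measurableD.
have mL : measurable (\bigcup_k leave k) by exact: bigcupT_measurable.
have L0 : P (\bigcup_k leave k) = 0%E.
  apply: measure_negligible => //; apply: negligible_bigcup => k.
  exists (leave k); split => //; rewrite /leave measureD//; last first.
    by change (P [set w | X k w = a] < +oo)%E; rewrite PrE// ltry.
  have -> : [set w | X k w = a] `&` [set w | X k w = a /\ X k.+1 w = a] =
      [set w | X k w = a /\ X k.+1 w = a].
    by apply/seteqP; split => w /= [].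
  change (P [set w | X k w = a] - P [set w | X k w = a /\ X k.+1 w = a] = 0)%E.
  by rewrite !PrE// Pr_step Kaa mulr1 -EFinB subrr.
have -> : Pr B = Pr (B `|` \bigcup_k leave k) by rewrite /Pr (measureU0 mB mL L0).
apply: le_Pr => //; first exact: measurableU.
move=> w /= wa; have [wL|wL] := pselect ((\bigcup_k leave k) w); [by right|left].
exists t => k.
suff st j : (t <= j)%N -> X j w = a by move=> tk; rewrite st.
elim: j => [|j jh]; first by rewrite leqn0 => /eqP t0; rewrite t0 in wa.
rewrite leq_eqVlt => /orP[/eqP <-//|tj]; have {}jh := jh tj.
by apply: contrapT => h; apply: wL; exists j => //; split => // -[].
Qed.

End chain_law.

Section limiting_spin.
Context {R : realType} (n : nat) (J : couplings n.+1) (s0 : config n.+1).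
Variable X : zero_temp_dynamics R J s0.

Let ev (b : bool) : set (chain_space X) :=
  [set w | exists t0, forall t, (t0 <= t)%N -> X t w ord0 == b].

Let mev b : measurable (ev b).
Proof. exact: (measurable_eventually X (fun s => s ord0 == b)). Qed.

Let evN b w : ev b w -> ~ ev (~~ b) w.
Proof.
move=> [t1 h1] [t2 h2].
have := h1 (maxn t1 t2) (leq_maxl _ _); have := h2 (maxn t1 t2) (leq_maxr _ _).
by move=> /eqP -> ; case: b {h1 h2}.
Qed.

Let lim_ev b w : ev b w ->
  lim_or0 (fun t => spin R (X t w) ord0) = if b then 1 else -1.
Proof.
move=> [t0 h]; set c := if b then _ else _; set u := fun t => _.
have uc : u @ \oo --> c.
  apply: cvg_near_cst; exists t0 => // t /= t0t.
  by rewrite /u /c /spin (eqP (h t t0t)).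
rewrite /lim_or0 asboolT; last by apply/cvg_ex; exists c.
exact: cvg_lim.
Qed.

Let lim_nev w : ~ ev true w -> ~ ev false w ->
  lim_or0 (fun t => spin R (X t w) ord0) = 0.
Proof.
move=> hT hF; rewrite /lim_or0; case: asboolP => // /cvg_ex[l ul]; exfalso.
have /cvgrPdist_lt/(_ 1 ltr01)[t0 _ h] := ul.
pose b := X t0 w ord0.
suff : ev b w by case: b.
exists t0 => t t0t; apply/eqP; rewrite /b.
have := h t t0t; have := h t0 (leqnn _); rewrite /spin /= !ltr_norml.
by case: (X t w ord0); case: (X t0 w ord0) => //= /andP[a1 a2] /andP[a3 a4]; lra.
Qed.

(** A sequence of signs converges only if it is eventually constant. *)
Lemma E_omegaE : E_omega X = Pr (ev true) - Pr (ev false).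
Proof.
rewrite /E_omega unlock.
have -> : (fun w => (lim_or0 (fun t => spin R (X t w) ord0))%:E) =
    (fun w => ((\1_(ev true) w)%:E - (\1_(ev false) w)%:E)%E).
  apply/funext => w; rewrite -EFinB; congr EFin; rewrite !indicE.
  have [hT|hT] := pselect (ev true w).
    rewrite (lim_ev hT) (mem_set hT) memNset ?subr0//.
    exact: evN hT.
  rewrite (memNset hT); have [hF|hF] := pselect (ev false w).
    by rewrite (lim_ev hF) (mem_set hF) sub0r.
  by rewrite (memNset hF) lim_nev// subr0.
have intI b : (chain_prob X).-integrable setT (fun w => (\1_(ev b) w)%:E).
  apply: integrable_indic => //.
rewrite integralB// !integral_indic// !setIT fineB//; exact: fin_num_measure.
Qed.

Lemma normr_E_omega : `|E_omega X| <= 1.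
Proof.
have le1 b : Pr (ev b) <= 1.
  rewrite -lee_fin /Pr fineK ?fin_num_measure//; exact: probability_le1.
rewrite E_omegaE ler_norml.
have := le1 true; have := le1 false.
have := Pr_ge0 (ev true); have := Pr_ge0 (ev false).
by move=> *; apply/andP; split; lra.
Qed.

Let Pr_ev_sum : Pr (ev true) + Pr (ev false) <= 1.
Proof.
have := le_Pr (mev true) (measurableC (mev false)) _; rewrite /Pr probability_setC//.
rewrite fineB ?fin_num_measure//= => h; rewrite -lerBrDr; apply: h.
by move=> w h1; exact: evN h1.
Qed.

Lemma E_omega_absorbed (a : config n.+1) t : (forall i, flip_prob R J a i = 0) ->
  1 - 2 * evolve J t (fun s => (s != a)%:R) s0 <=
  (if a ord0 then 1 else -1) * E_omega X.
Proof.
move=> fp0.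
have Kaa : zero_temp_kernel R J a a = 1.
  by rewrite /zero_temp_kernel eqxx big1 ?subr0.
have h := @Pr_absorbed _ _ _ _ X t a (fun s => s ord0 == a ord0) Kaa (eqxx _).
have law := chain_law X t (fun s => (s != a)%:R).
have law1 := chain_law X t (fun s => 1).
have it1 k s : iter k (chain_op (zero_temp_kernel R J)) (fun=> 1) s = 1.
  elim: k s => //= k ih s.
  rewrite -[RHS](_ : kernel_op J (fun=> 1) s = 1); last first.
    by rewrite kernel_opE subrr big1 ?addr0// => i _; rewrite mulr0.
  by apply: eq_bigr => y _; rewrite ih.
rewrite it1 in law1.
have e1 : evolve J t (fun s => (s != a)%:R) s0 = 1 - Pr [set w | X t w = a].
  apply: (canRL (addrK _)); rewrite /evolve -[X in X + _]law -[RHS]law1.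
  rewrite (bigD1 a)//= eqxx mulr0 add0r [RHS](bigD1 a)//= mulr1 addrC.
  by congr (_ + _); apply: eq_bigr => y ya; rewrite ya.
rewrite e1 E_omegaE; have := Pr_ev_sum; move: h; rewrite -/(ev (a ord0)).
by case: (a ord0); lra.
Qed.

End limiting_spin.

(** * Initial magnetization *)

Section initial_state.
Local Open Scope nat_scope.

Lemma bin_central_max m k : 'C(m.*2, k) <= 'C(m.*2, m).
Proof.
suff low d j : j + d = m -> 'C(m.*2, j) <= 'C(m.*2, m).
  have [km|mk] := leqP k m; first by apply: (low (m - k)); rewrite subnKC.
  have [k2|k2] := leqP k m.*2; last by rewrite bin_small.
  rewrite -(bin_sub k2); apply: (low (k - m)).
  by rewrite -addnn; lia.
elim: d j => [|d ih] j jd; first by rewrite -jd addn0.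
apply: leq_trans (ih j.+1 _); last by rewrite addSnnS.
rewrite -(leq_pmul2l (ltn0Sn j)) mul_bin_left leq_mul2r; apply/orP; right.
by rewrite -addnn; lia.
Qed.

(** The induction step is
    [(2m + 1) * (2m + 3) <= (2m + 2) ^ 2]. *)
Lemma bin_central_sqr m : m.*2.+1 * 'C(m.*2, m) ^ 2 <= 16 ^ m.
Proof.
elim: m => [//|m ih].
have rec : m.+1 * 'C(m.+1.*2, m.+1) = 2 * m.*2.+1 * 'C(m.*2, m).
  have e1 := mul_bin_diag m.*2.+2 m; rewrite /= in e1.
  have e2 := mul_bin_down m.*2.+1 m; rewrite /= in e2.
  have e3 : m.*2.+1 - m = m.+1 by rewrite -addnn; lia.
  rewrite e3 in e2; rewrite doubleS -e1.
  apply/eqP; rewrite -(eqn_pmul2l (ltn0Sn m)) mulnCA -e2; apply/eqP.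
  by rewrite -addnn; nia.
have pos : 0 < m.+1 ^ 2 by rewrite expn_gt0.
rewrite -(leq_pmul2l pos).
have -> : m.+1 ^ 2 * (m.+1.*2.+1 * 'C(m.+1.*2, m.+1) ^ 2) =
    m.+1.*2.+1 * (m.+1 * 'C(m.+1.*2, m.+1)) ^ 2 by rewrite expnMn mulnCA.
rewrite rec.
have -> : m.+1.*2.+1 * (2 * m.*2.+1 * 'C(m.*2, m)) ^ 2 =
    (4 * m.+1.*2.+1 * m.*2.+1) * (m.*2.+1 * 'C(m.*2, m) ^ 2).
  by rewrite !expnMn; move: ('C(_, _) ^ 2) => c; rewrite -[m.*2.+1 ^ 2]mulnn; lia.
rewrite (expnS 16) [leqRHS]mulnA; apply: leq_mul => //.
by rewrite -mulnn -!addnn; nia.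
Qed.

Lemma bin_sqr_le n k : n * 'C(n, k) ^ 2 <= 4 ^ n.
Proof.
have sq a b : a <= b -> a ^ 2 <= b ^ 2 by move=> ab; rewrite leq_exp2r.
rewrite -(odd_double_half n); case: (odd n); set m := n./2; last first.
  rewrite add0n; apply: (@leq_trans (m.*2.+1 * 'C(m.*2, m) ^ 2)).
    by apply: leq_mul; [exact: leqnSn|apply: sq; exact: bin_central_max].
  by apply: (leq_trans (bin_central_sqr m)); rewrite -muln2 mulnC expnM.
rewrite add1n; apply: (@leq_trans (m.*2.+1 * (2 * 'C(m.*2, m)) ^ 2)).
  apply: leq_mul => //; apply: sq; case: k => [|k].
    by rewrite bin0 muln_gt0 bin_gt0 -addnn leq_addr.
  by rewrite binS mulSn mul1n; apply: leq_add; exact: bin_central_max.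
rewrite expnMn mulnCA (expnS 4); apply: leq_mul => //.
by apply: (leq_trans (bin_central_sqr m)); rewrite -muln2 mulnC expnM.
Qed.

End initial_state.

Section initial_magnetization.
Context {R : realType} (N : nat).
Hypothesis N0 : (0 < N)%N.

Lemma card_config : #|config N| = (2 ^ N)%N.
Proof. by rewrite card_ffun card_bool card_ord. Qed.

Let small (w : R) (k : nat) : bool := `|k%:R * 2 - N%:R| < w.

Let card_small (w : R) : 0 <= w ->
  #|[set k : 'I_N.+1 | small w k]%SET|%:R <= w + 1.
Proof.
move=> w0; set A := [set k | _]%SET.
have [->|[k0 k0A]] := set_0Vmem A; first by rewrite cards0 addr_ge0.
case: (@arg_minnP _ k0 (mem A) val k0A) => k1 k1A k1min.
have lt_w k : k \in A -> (k - k1 < (Num.truncn w).+1)%N.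
  move=> kA; rewrite ltnS truncn_ge_nat// natrB ?k1min//.
  move: kA k1A; rewrite !inE /small !ltr_norml => /andP[a1 a2] /andP[b1 b2].
  lra.
have := @leq_card_in _ _ (fun k : 'I_N.+1 => inord (k - k1) : 'I_(Num.truncn w).+1) (mem A) _.
rewrite card_ord => h; apply: (@le_trans _ _ (Num.truncn w).+1%:R).
  rewrite ler_nat; apply: h => x y xA yA /(congr1 val).
  rewrite /= !inordK ?lt_w// => e; apply/val_inj => /=.
  by rewrite -(subnK (k1min x xA)) e subnK// k1min.
by rewrite -natr1 lerD2r; have /andP[] := truncn_itv w0.
Qed.

(** Every value of the magnetization has probability at most
    [(Num.sqrt N)^-1], and at most [w + 1] values have modulus below [w]. *)
Lemma init_small_magn (w : R) : 0 <= w ->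
  E_init (fun s : config N => (`|magn s| < w)%R%:R) <=
  (w + 1) / Num.sqrt N%:R.
Proof.
move=> w0; have NR : 0 < N%:R :> R by rewrite ltr0n.
have sN : 0 < Num.sqrt N%:R :> R by rewrite sqrtr_gt0.
have binR k : 'C(N, k)%:R <= 2 ^+ N / Num.sqrt N%:R :> R.
  rewrite ler_pdivlMr//.
  rewrite -(@ler_pXn2r _ 2)// ?nnegrE ?mulr_ge0 ?exprn_ge0// ?(ltW sN)//.
  rewrite exprMn sqr_sqrtr// -exprM mulnC exprM -!natrX -natrM ler_nat mulnC.
  exact: bin_sqr_le.
have magnE (s : config N) : magn s = #|[set i | s i]%SET|%:R * 2 - N%:R :> R.
  have NE : N%:R = \sum_(i < N) (1 : R) by rewrite sumr_const card_ord.
  rewrite /magn NE -sum_indicator mulr_suml -sumrB; apply: eq_bigr => i _; rewrite inE /spin.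
  by case: (s i); rewrite ?mul1r ?mul0r; lra.
have -> : E_init (fun s : config N => (`|magn s| < w)%R%:R) =
    (2 ^+ N)^-1 * \sum_(k < N.+1 | small w k) ('C(N, k)%:R : R).
  rewrite /E_init card_config natrX; congr (_ * _).
  pose h (A : {set 'I_N}) : config N := [ffun i => i \in A].
  have hbij : bijective h.
    exists (fun s : config N => [set i | s i]%SET).
      by move=> A; apply/setP => i; rewrite inE ffunE.
    by move=> s; apply/ffunP => i; rewrite ffunE inE.
  rewrite (reindex h) /=; last exact: onW_bij.
  have szA (A : {set 'I_N}) : (#|A| < N.+1)%N.
    by rewrite ltnS -[leqRHS](card_ord N) max_card.
  rewrite (partition_big (fun A : {set 'I_N} => Ordinal (szA A)) xpredT)//=.
  rewrite [RHS]big_mkcond; apply: eq_bigr => k _.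
  rewrite (eq_bigr (fun=> (small w k)%:R)); last first.
    move=> A /eqP <-; rewrite magnE /small /=.
    by rewrite (_ : [set i | h A i]%SET = A)//; apply/setP => i; rewrite inE ffunE.
  rewrite sumr_const.
  have -> : #|[pred A : {set 'I_N} | Ordinal (szA A) == k]| = 'C(N, k).
    transitivity 'C(#|'I_N|, k); last by rewrite card_ord.
    by rewrite -card_draws; apply: eq_card => A; rewrite !inE -val_eqE.
  by case: (small w k); rewrite ?mul0rn.
rewrite mulrC ler_pdivrMr ?exprn_gt0//.
apply: (le_trans (ler_sum _ (fun (k : 'I_N.+1) _ => binR k))).
rewrite sumr_const -[leLHS]mulr_natr.
have -> : (w + 1) / Num.sqrt N%:R * 2 ^+ N = 2 ^+ N / Num.sqrt N%:R * (w + 1) by ring.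
apply: ler_wpM2l; first by rewrite divr_ge0 ?exprn_ge0// ltW.
apply: le_trans (card_small w0); rewrite le_eqVlt; apply/orP; left; apply/eqP.
by congr (_%:R); apply: eq_card => k; rewrite !inE.
Qed.

End initial_magnetization.

(** * Absorption for typical couplings *)

Section deterministic.
Context {R : realType} (N : nat) (J : couplings N).
Hypothesis N0 : (0 < N)%N.
Implicit Types (s : config N) (u : config N -> R) (t k : nat).

Let NR : 0 < N%:R :> R. Proof. by rewrite ltr0n. Qed.

Definition all_plus : config N := [ffun=> true].

Definition unabsorbed s : R := (s != all_plus)%:R.

Definition dist s s' : nat := #|[set i | s i != s' i]%SET|.

Definition spin_diff s s' (i : 'I_N) : R := spin R s i - spin R s' i.

Lemma normr_spin_diff s s' i : `|spin_diff s s' i| = (s i != s' i)%:R * 2.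
Proof.
rewrite /spin_diff /spin; case: (s i); case: (s' i);
  rewrite ?subrr ?normr0 ?mul0r ?mul1r//=.
- by rewrite opprK ger0_norm.
- by rewrite -opprD normrN ger0_norm.
Qed.

Lemma sum_normr_spin_diff s s' : \sum_i `|spin_diff s s' i| = (dist s s')%:R * 2.
Proof.
rewrite /dist -sum_indicator mulr_suml; apply: eq_bigr => i _.
by rewrite normr_spin_diff inE.
Qed.

Lemma sum_spin_diff_sqr s s' : \sum_i spin_diff s s' i ^+ 2 = (dist s s')%:R * 4.
Proof.
rewrite /dist -sum_indicator mulr_suml; apply: eq_bigr => i _.
rewrite -real_normK ?num_real// normr_spin_diff inE exprMn.
by case: (s i != s' i); rewrite ?expr1n ?expr0n //=; ring.
Qed.

Lemma sum_spin_diff s s' : \sum_i spin_diff s s' i = magn s - magn s'.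
Proof. by rewrite /magn -sumrB. Qed.

Lemma field_spin_diff s s' i :
  field J (spin R s) i = field J (spin R s') i + field J (spin_diff s s') i.
Proof.
rewrite -fieldD; congr (field J _ i); apply/funext => k.
by rewrite /spin_diff addrC subrK.
Qed.

Lemma dist_flip s s' i : (dist (flip s i) s' <= (dist s s').+1)%N.
Proof.
rewrite /dist; apply: (@leq_trans #|i |: [set i | s i != s' i]%SET|).
  apply: subset_leq_card; apply/fintype.subsetP => k; rewrite !inE ffunE.
  by case: (k == i).
by rewrite cardsU1 -add1n leq_add2r leq_b1.
Qed.

Lemma spin_all_plus : spin R all_plus = fun=> 1.
Proof. by apply/funext => i; rewrite /spin ffunE. Qed.

Lemma magn_all_plus : magn all_plus = N%:R :> R.
Proof. by rewrite /magn spin_all_plus sumr_const card_ord. Qed.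

Lemma magn_le s : magn s <= N%:R :> R.
Proof.
rewrite -magn_all_plus; apply: ler_sum => i _.
by rewrite spin_all_plus /spin; case: (s i); lra.
Qed.

Lemma unabsorbed_le1 s : unabsorbed s <= 1.
Proof. by rewrite /unabsorbed; case: (_ != _). Qed.

Lemma exp_contraction (x : R) n : 0 <= x <= 1 -> (1 - x) ^+ n <= expR (- (n%:R * x)).
Proof.
move=> /andP[x0 x1]; rewrite -mulrN mulr_natl -mulr_natl mulrC expRM_natr.
by rewrite lerXn2r ?nnegrE ?subr_ge0 ?expR_ge0// expR_ge1Dx.
Qed.

Lemma ge1_expmagn (a theta : R) s : 0 <= theta -> magn s <= a ->
  1 <= expR (theta * a) * expmagn theta s.
Proof.
move=> th0 sa; rewrite /expmagn -expRD -mulrBr -expR0 ler_expR.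
by rewrite mulr_ge0// subr_ge0.
Qed.

(** Once the magnetization is macroscopic, the expander-like property of the
    couplings makes almost every field positive, and the degrees make all of
    them positive near the end; the drift never stops before absorption. *)
Lemma macroscopic_absorption (p kappa : R) : 0 < p <= 1 ->
  (forall i, p / 2 * N%:R < field J (fun=> 1) i) ->
  (forall s, kappa * N%:R <= magn s ->
     #|[set i | field J (spin R s) i <= 0]%SET|%:R <= p / 8 * N%:R) ->
  (forall i, flip_prob R J all_plus i = 0) /\
  forall t s, evolve J t unabsorbed s <=
    (expR (p / 64 * (kappa * N%:R)) +
     (1 - (p / 64) ^+ 2 / N%:R) ^+ t * expR (p / 64 * N%:R)) *
    expmagn (p / 64) s.
Proof.
move=> /andP[p0 p1] Hdeg Hexc; set theta := p / 64.
have th0 : 0 < theta by rewrite divr_gt0.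
have th1 : theta <= 64^-1 by rewrite /theta; lra.
have fp0 i : flip_prob R J all_plus i = 0.
  apply: flip_prob_aligned => //; rewrite spin_all_plus mul1r.
  by apply: lt_trans (Hdeg i); rewrite mulr_gt0// divr_gt0.
split => // t s.
have N1 : 1 <= N%:R :> R by rewrite ler1n.
have rle : theta ^+ 2 / N%:R <= theta / N%:R.
  by rewrite ler_pM2r ?invr_gt0//; nra.
have rle2 : theta ^+ 2 / N%:R <= 8 * theta ^+ 2.
  rewrite ler_pdivrMr//; have := sqr_ge0 theta; nra.
have r01 : 0 <= 1 - theta ^+ 2 / N%:R <= 1.
  have r0 : 0 <= theta ^+ 2 / N%:R by rewrite divr_ge0 ?sqr_ge0// ltW.
  by apply/andP; split; nra.
have phi0 s' : 0 <= expmagn theta s' by exact: expR_ge0.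
have stay k : evolve J k unabsorbed all_plus = 0.
  elim: k => [|k ih]; first by rewrite /evolve /= /unabsorbed eqxx.
  rewrite /evolve /= kernel_opE -/(evolve J k unabsorbed) ih add0r.
  by rewrite big1// => i _; rewrite fp0 mul0r.
have step k s' : true -> [\/ 1 <= expR (theta * (kappa * N%:R)) * expmagn theta s',
    kernel_op J (expmagn theta) s' <= (1 - theta ^+ 2 / N%:R) * expmagn theta s' |
    evolve J k.+1 unabsorbed s' <= 0].
  move=> _; have [lowM|M] := ltP (magn s') (kappa * N%:R).
    by apply: Or31; apply: ge1_expmagn; exact: ltW.
  have [->|s'P] := eqVneq s' all_plus; first by apply: Or33; rewrite stay.
  apply: Or32; have [i si] : exists i, ~~ s' i.
    apply/existsP; apply: contraNT s'P; rewrite negb_exists => /forallP h.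
    by apply/eqP/ffunP => i; rewrite ffunE; have := h i; rewrite negbK.
  (* When few negative spins are left, they cannot outweigh the degrees. *)
  have [nearend|far] := leP (N%:R - magn s') (p / 2 * N%:R).
    have pos j : 0 < field J (spin R s') j.
      rewrite (field_spin_diff s' all_plus) spin_all_plus.
      have := Hdeg j; have := normr_field J (spin_diff s' all_plus) j.
      rewrite ler_norml => /andP[h _] hd.
      suff : \sum_k `|spin_diff s' all_plus k| <= p / 2 * N%:R by lra.
      apply: le_trans nearend; rewrite -magn_all_plus -sum_spin_diff.
      apply: ler_sum => l _; rewrite /spin_diff spin_all_plus distrC ger0_norm//.
      by rewrite /spin; case: (s' l); lra.
    apply: (le_trans (@kernel_op_end _ _ _ N0 theta s' i _ si pos)).
      by apply/andP; split; lra.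
    by rewrite ler_wpM2r// lerD2l lerN2.
  apply: (@le_trans _ _ ((1 - 8 * theta ^+ 2) * expmagn theta s')); last first.
    by rewrite ler_wpM2r// lerD2l lerN2.
  apply: kernel_op_drift => //; first by apply/andP; split; lra.
  have := Hexc s' M; have := cardsC [set i | field J (spin R s') i <= 0]%SET.
  have -> : (~: [set i | field J (spin R s') i <= 0])%SET =
      [set i | 0 < field J (spin R s') i]%SET.
    by apply/setP => j; rewrite !inE ltNge.
  rewrite card_ord => /(congr1 (fun k => k%:R : R)); rewrite natrD.
  set a := #|_|%:R; set b := #|_|%:R => ab ale; rewrite /theta; lra.
have G0 s' : true -> unabsorbed s' <= expR (theta * N%:R) * expmagn theta s' + 0.
  move=> _; rewrite addr0; apply: (le_trans (unabsorbed_le1 s')).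
  by apply: ge1_expmagn; [exact: ltW|exact: magn_le].
have := @supermartingale_bound _ _ J N0 unabsorbed (expmagn theta)
  (fun _ => predT) _ _ _ 0 (expR_ge0 _) (expR_ge0 _) r01 (lexx 0) phi0
  unabsorbed_le1 _ G0 step t s isT.
by rewrite addr0; apply.
Qed.

(** As long as few spins have changed and the magnetization has not dropped by
    more than [lam * sqrt N], the fields have lost at most a small multiple of [sqrt N] outside a small
    set of sites, whatever state the dynamics has reached; so the initial bias
    of the fields drives the magnetization up. *)
Lemma initial_growth (p lam c tau kappa eta : R) (s0 : config N) u (T : nat) :
  0 < p <= 1 -> 2 <= lam * Num.sqrt N%:R -> 0 < c <= 1 -> kappa + tau <= c / 2 ->
  magn s0 <= 2 * (kappa * N%:R) -> 0 <= eta ->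
  (2^-1 + c) * N%:R <=
    #|[set j | 3 * (lam * Num.sqrt N%:R) <= field J (spin R s0) j]%SET|%:R ->
  (forall s, (dist s s0)%:R <= tau * N%:R ->
    #|[set i | field J (spin_diff s s0) i <=
       p * (\sum_k spin_diff s s0 k - spin_diff s s0 i) -
       lam * Num.sqrt N%:R]%SET|%:R <= c / 4 * N%:R) ->
  (forall s, u s <= 1) -> (forall s, 2 * (kappa * N%:R) <= magn s -> u s <= eta) ->
  T%:R <= tau * N%:R ->
  evolve J T u s0 <=
    (expR (c / 32 * (magn s0 - lam * Num.sqrt N%:R)) +
     (1 - 8 * (c / 32) ^+ 2) ^+ T * expR (c / 32 * (2 * (kappa * N%:R)))) *
    expmagn (c / 32) s0 + eta.
Proof.
move=> /andP[p0 p1]; set L := lam * _ => L2 /andP[c0 c1] kt M0 eta0 HA H3 u1 ueta TN.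
set theta := c / 32.
have th0 : 0 < theta by rewrite divr_gt0.
have th1 : theta <= 32^-1 by rewrite /theta; lra.
have r01 : 0 <= 1 - 8 * theta ^+ 2 <= 1.
  by apply/andP; split; have := sqr_ge0 theta; nra.
have phi0 s : 0 <= expmagn theta s by exact: expR_ge0.
pose G k s := (dist s s0 + k <= T)%N.
have GS k s i : G k.+1 s -> G k s && G k (flip s i).
  rewrite /G => h; apply/andP; split; first by apply: leq_trans h; rewrite leq_add2l.
  by apply: leq_trans h; rewrite addnS -addSn leq_add2r dist_flip.
have G0 s : G 0%N s -> u s <= expR (theta * (2 * (kappa * N%:R))) * expmagn theta s + eta.
  move=> _; have [M|M] := leP (2 * (kappa * N%:R)) (magn s).
    by apply: (le_trans (ueta s M)); rewrite lerDr mulr_ge0// expR_ge0.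
  apply: (le_trans (u1 s)).
  apply: (@le_trans _ _ (expR (theta * (2 * (kappa * N%:R))) * expmagn theta s)).
    by apply: ge1_expmagn; exact: ltW.
  by rewrite lerDl.
have step k s : G k.+1 s -> [\/ 1 <= expR (theta * (magn s0 - L)) * expmagn theta s,
    kernel_op J (expmagn theta) s <= (1 - 8 * theta ^+ 2) * expmagn theta s |
    evolve J k.+1 u s <= eta].
  move=> Gs; have [lowM|M] := ltP (magn s) (magn s0 - L).
    by apply: Or31; apply: ge1_expmagn; exact: ltW.
  apply: Or32; apply: kernel_op_drift => //; first by apply/andP; split; lra.
  have dN : (dist s s0)%:R <= tau * N%:R.
    apply: le_trans TN; rewrite ler_nat; apply: leq_trans Gs; exact: leq_addr.
  have exc := H3 s dN; move: exc.
  set A := [set i | _ <= p * _ - _]%SET => exc.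
  set Bs := [set i | 0 < field J (spin R s) i]%SET.
  (* Outside the exceptional set [A], a field that was at least [3 * L] has lost
     at most [L] by fluctuation, [p * L] by the decrease of the magnetization
     and [2 * p] by the spin at [i] itself. *)
  have cover : #|[set j | (3 * L <= field J (spin R s0) j)%R]%SET|%:R <=
      #|Bs|%:R + #|A|%:R :> R.
    rewrite -natrD ler_nat; apply: leq_trans (leq_card_setU Bs A).
    apply: subset_leq_card; apply/fintype.subsetP => i; rewrite !inE => hi.
    case: (leP (field J (spin_diff s s0) i) _) => /= h; first by rewrite orbT.
    rewrite orbF (field_spin_diff s s0); move: h; rewrite sum_spin_diff.
    have := normr_spin_diff s s0 i; have : `|spin_diff s s0 i| <= 2.
      by rewrite normr_spin_diff ler_piMl//; case: (s i != s0 i).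
    rewrite ler_norml => /andP[v1 v2] _ h.
    have : p * (- L - 2) <= p * (magn s - magn s0 - spin_diff s s0 i).
      rewrite ler_pM2l//. lra.
    by nra.
  have Mup : magn s <= magn s0 + 2 * (tau * N%:R).
    have := ler_sum (index_enum 'I_N) (fun i (_ : true) => ler_norm (spin_diff s s0 i)).
    rewrite sum_spin_diff sum_normr_spin_diff; lra.
  have ktN : (kappa + tau) * N%:R <= c / 2 * N%:R by rewrite ler_wpM2r// ltW.
  rewrite /theta; lra.
have Gs0 : G T s0.
  rewrite /G /dist (_ : [set i | s0 i != s0 i]%SET = finset.set0) ?cards0//.
  by apply/setP => i; rewrite !inE eqxx.
exact: (@supermartingale_bound _ _ J N0 u (expmagn theta) G _ _ _ eta
  (expR_ge0 _) (expR_ge0 _) r01 eta0 phi0 u1 GS G0 step T s0 Gs0).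
Qed.

End deterministic.

Section large_systems.
Context {R : realType}.
Implicit Types (a b eta K : R).

Lemma near_sqrt_ge K : \forall N \near \oo, K <= Num.sqrt N%:R.
Proof.
near=> N; apply: (le_trans (ler_norm K)); rewrite -sqrtr_sqr; apply: ler_wsqrtr.
by near: N; exact: nbhs_infty_ger.
Unshelve. all: by end_near. Qed.

Lemma near_exp_sqrt a eta : 0 < a -> 0 < eta ->
  \forall N \near \oo, expR (- (a * Num.sqrt N%:R)) <= eta.
Proof.
move=> a0 eta0; near=> N.
have h : (a * eta)^-1 <= Num.sqrt N%:R by near: N; exact: near_sqrt_ge.
have s0 : 0 < Num.sqrt N%:R :> R.
  by apply: lt_le_trans h; rewrite invr_gt0 mulr_gt0.
apply: le_trans (expRN_le_inv _) _; first by rewrite mulr_gt0.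
rewrite -[leRHS]invrK lef_pV2 ?posrE ?invr_gt0 ?mulr_gt0//.
have -> : eta^-1 = a * (a * eta)^-1 by field; rewrite !gt_eqF.
by rewrite ler_pM2l.
Unshelve. all: by end_near. Qed.

Lemma near_exp a eta : 0 < a -> 0 < eta ->
  \forall N \near \oo, expR (- (a * N%:R)) <= eta.
Proof.
move=> a0 eta0; near=> N.
apply: (@le_trans _ _ (expR (- (a * Num.sqrt N%:R)))); last first.
  by near: N; exact: near_exp_sqrt.
rewrite ler_expR lerN2 ler_pM2l//.
have s1 : 1 <= Num.sqrt N%:R :> R by near: N; exact: near_sqrt_ge.
rewrite -[leRHS]sqr_sqrtr// expr2 ler_peMl//; exact: le_trans s1.
Unshelve. all: by end_near. Qed.

Lemma near_exp_sqr a b eta : 0 < a -> 0 < eta ->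
  \forall N \near \oo, expR (b * N%:R - a * N%:R ^+ 2) <= eta.
Proof.
move=> a0 eta0; near=> N.
apply: (@le_trans _ _ (expR (- (1 * N%:R)))); last first.
  by near: N; exact: near_exp.
have h : (b + 1) / a <= N%:R by near: N; exact: nbhs_infty_ger.
rewrite ler_pdivrMr// in h; rewrite ler_expR.
have : 0 <= N%:R :> R by [].
by nra.
Unshelve. all: by end_near. Qed.

Lemma near_mul_exp a eta : 0 < a -> 0 < eta ->
  \forall N \near \oo, N%:R * expR (- (a * N%:R)) <= eta.
Proof.
move=> a0 eta0; have a2 : 0 < a / 2 by rewrite divr_gt0.
near=> N; have N1 : 1 <= N%:R :> R by near: N; exact: nbhs_infty_ger.
have N0 : 0 < N%:R :> R by lra.
have h1 : expR (- (a / 2 * N%:R)) <= (a / 2 * N%:R)^-1.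
  by apply: expRN_le_inv; rewrite mulr_gt0.
have h2 : expR (- (a / 2 * N%:R)) <= eta * (a / 2).
  by near: N; apply: near_exp => //; rewrite mulr_gt0.
have -> : - (a * N%:R) = - (a / 2 * N%:R) + - (a / 2 * N%:R) :> R by lra.
rewrite expRD.
have -> : eta = N%:R * ((a / 2 * N%:R)^-1 * (eta * (a / 2))).
  by field; rewrite !gt_eqF.
by rewrite ler_wpM2l// ler_pM// expR_ge0.
Unshelve. all: by end_near. Qed.

Lemma entropy_le (N : nat) : 2 ^+ N * 2 ^+ N <= expR (2 * N%:R) :> R.
Proof.
rewrite -exprMn expRM_natr lerXn2r ?nnegrE ?expR_ge0//.
have -> : 2 = 1 + 1 :> R by [].
by rewrite expRD; have := expR_ge1Dx (1 : R); nra.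
Qed.

Section typical_couplings.
Variable N : nat.
Implicit Types (J : couplings N).

(** A typical [J] has the four properties below.  This one says that an initial
    magnetization of order [sqrt N] makes more than half of the fields
    positive, with a margin proportional to [sqrt N]. *)
Definition biased (lam c : R) (s0 : config N) J : bool := ((2^-1 + c) * N%:R <=
  #|[set j | (3 * (lam * Num.sqrt N%:R) <= field J (spin R s0) j)%R]%SET|%:R)%R.

(** This one carries the previous property over to all states met during the
    first [tau * N] steps. *)
Definition stable (p lam c tau : R) (s0 : config N) J : bool :=
  [forall s, ((dist s s0)%:R <= tau * N%:R) ==>
    (#|[set i | field J (spin_diff s s0) i <=
       p * (\sum_k spin_diff s s0 k - spin_diff s s0 i) -
       lam * Num.sqrt N%:R]%SET|%:R <= c / 4 * N%:R)].

(** This one keeps the drift positive once the magnetization is macroscopic. *)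
Definition spreading (p kappa : R) J : bool :=
  [forall s : config N, (kappa * N%:R <= magn s) ==>
     (#|[set i | field J (spin R s) i <= 0]%SET|%:R <= p / 8 * N%:R)].

(** This one makes the constant states traps, and their neighbourhoods basins
    of attraction. *)
Definition dense (p : R) J : bool :=
  [forall i, p / 2 * N%:R < field J (fun=> 1) i].

End typical_couplings.

(** The threshold [3 * lam * sqrt N] is half of the value [p * d / 4] at which
    [typical_fields] sees a bias, with [d = eps * sqrt N / 2], and [4 * c] is this
    bias [(8 * m ^ 2)^-1] above 1/2; three quarters of it pay for the errors. *)
Lemma near_biased (p eps : R) : 0 < p < 1 -> 0 < eps <= 1 ->
  exists lam c : R, [/\ 0 < lam, 0 < c <= 1 & forall eta, 0 < eta ->
    \forall N \near \oo, forall s0 : config N, eps * Num.sqrt N%:R <= magn s0 ->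
      Pbern p (fun J => ~~ biased lam c s0 J) <= eta].
Proof.
move=> /andP[p0 p1] /andP[eps0 eps1].
have p01 : 0 <= p <= 1 by rewrite !ltW.
have lam0 : 0 < p * eps / 48 by rewrite divr_gt0// mulr_gt0.
have lam1 : p * eps / 48 <= 1.
  have : p * eps <= 1 * 1 by apply: ler_pM => //; exact: ltW.
  by lra.
pose m := (Num.truncn (64 / (p * eps))).+1.
have mR : 64 <= m%:R * (p * eps).
  by rewrite -ler_pdivrMr ?mulr_gt0// ltW// truncnS_gt.
have m0 : (0 < m)%N by [].
move: m mR m0 => m mR m0.
have m1 : 1 <= m%:R ^+ 2 :> R by rewrite exprn_ege1// ler1n.
pose c : R := (8 * m%:R ^+ 2)^-1 / 4.
have c1E : (8 * m%:R ^+ 2)^-1 = 4 * c by rewrite /c; field; rewrite pnatr_eq0 -lt0n.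
have c0 : 0 < c by rewrite divr_gt0// invr_gt0 mulr_gt0// exprn_gt0// ltr0n.
have c1 : c <= 32^-1.
  rewrite /c ler_pdivrMr// invf_ple ?posrE ?mulr_gt0 ?exprn_gt0 ?ltr0n//.
  by clear -m1; lra.
move: c c1E c0 c1 => c c1E c0 c1.
set lam := p * eps / 48 in lam0 lam1 *.
exists lam, c; split => //; first by rewrite c0; clear -c1; lra.
move=> eta eta0; near=> N => s0 Ms0.
have N4 : 4 <= N%:R :> R by near: N; exact: nbhs_infty_ger.
have sN1 : 1 <= Num.sqrt N%:R :> R by near: N; exact: near_sqrt_ge.
have F2 : 2 <= Num.sqrt N%:R * eps.
  by rewrite -ler_pdivrMr//; near: N; exact: near_sqrt_ge.
have F3 : expR (- ((p ^+ 2 * eps / 64) * Num.sqrt N%:R)) <= c.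
  by near: N; apply: near_exp_sqrt => //; rewrite divr_gt0// mulr_gt0// exprn_gt0.
have F4 : expR (- ((9 * c ^+ 2 * lam ^+ 2 / 4) * N%:R)) <= eta.
  by near: N; apply: near_exp => //; rewrite divr_gt0// !mulr_gt0// exprn_gt0.
have N0 : 0 <= N%:R :> R by [].
have := sqr_sqrtr N0; rewrite /biased.
have [x xE] : exists x : R, x = Num.sqrt N%:R by eexists.
rewrite -xE in sN1 F2 F3 Ms0 * => x2.
have x0 : 0 < x by clear -sN1; lra.
have d0 : 0 < eps * x / 2 by rewrite divr_gt0// mulr_gt0.
have dM : eps * x / 2 + 1 <= \sum_k spin R s0 k.
  by apply: le_trans Ms0; clear -F2; lra.
have mN : 8 * Num.sqrt N%:R <= m%:R * (p * (eps * x / 2) / 4).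
  by have := ler_wpM2r (ltW x0) mR; rewrite -xE; clear; lra.
have y0 : 0 < 3 * (lam * x) by rewrite !mulr_gt0.
have xd : 2 * (3 * (lam * x)) <= p * (eps * x / 2) / 4 by rewrite /lam; clear; lra.
have q0 : 0 < 2 * c by rewrite mulr_gt0.
have qx : 2 * c * (3 * (lam * x)) <= 2 * N%:R.
  have h1 : c * lam <= 32^-1 * 1 by apply: ler_pM => //; exact: ltW.
  have h2 : x <= N%:R by rewrite -x2 expr2 ler_peMl// ltW.
  have : c * lam * x <= 32^-1 * 1 * N%:R.
    by apply: ler_pM => //; rewrite ?mulr_ge0// ltW.
  by move: N0; clear; lra.
have := typical_fields p01 p0 d0 dM N4 m0 mN y0 xd q0 qx.
rewrite c1E => h; apply: le_trans F4; apply: (@le_trans _ _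
  (expR (- ((2 * c) ^+ 2 * (3 * (lam * x)) ^+ 2 / 16)))); last first.
  by rewrite ler_expR lerN2 -x2; clear; lra.
apply: le_trans h; apply: le_Pbern => // J; rewrite -ltNge => /ltW /le_trans; apply.
rewrite ler_wpM2r//.
have -> : p ^+ 2 * (eps * x / 2) / 32 = p ^+ 2 * eps / 64 * x by clear; field.
by move: F3; clear; lra.
Unshelve. all: by end_near. Qed.

Lemma near_stable (p lam c tau eta : R) : 0 <= p <= 1 -> 0 < lam -> 0 < c ->
  0 < tau -> tau <= lam ^+ 2 * c / 768 -> 0 < eta ->
  \forall N \near \oo, forall s0 : config N,
    Pbern p (fun J => ~~ stable p lam c tau s0 J) <= eta.
Proof.
move=> p01 lam0 c0 tau0 taul eta0; near=> N => s0.
have N0 : (0 < N)%N by near: N; exact: nbhs_infty_ge.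
have NR : 0 < N%:R :> R by rewrite ltr0n.
have sN : 0 < Num.sqrt N%:R :> R by rewrite sqrtr_gt0.
have b0 : 0 < c / 4 by rewrite divr_gt0.
have L0 : 0 < lam * Num.sqrt N%:R by rewrite mulr_gt0.
have LV : lam * Num.sqrt N%:R <= 4 * tau * N%:R.
  have h : lam / (4 * tau) <= Num.sqrt N%:R by near: N; exact: near_sqrt_ge.
  rewrite ler_pdivrMr ?mulr_gt0// in h.
  have := ler_wpM2r (ltW sN) h; rewrite [X in _ <= X -> _]mulrAC -expr2.
  by rewrite sqr_sqrtr ?(ltW NR)// [N%:R * _]mulrC.
have vs (s : config N) : (dist s s0)%:R <= tau * N%:R ->
    (forall k, `|spin_diff s s0 k| <= 2 :> R) /\
    \sum_k (spin_diff s s0 k : R) ^+ 2 <= 4 * tau * N%:R.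
  move=> ds; split=> [k|]; last by rewrite sum_spin_diff_sqr; move: ds; clear; lra.
  by rewrite normr_spin_diff ler_piMl//; case: (s k != s0 k).
have := mixing_uniform p01 N0 b0 L0 LV vs.
rewrite card_config natrX => h.
have small : expR (- (1 * N%:R)) <= eta by near: N; exact: near_exp.
apply: le_trans small; apply: (le_trans _ (le_trans h _)).
  apply: le_Pbern => // J; rewrite /stable negb_forall => /existsP[s].
  rewrite negb_imply -ltNge => /andP[ds hs]; apply/existsP; exists s.
  by rewrite ds ltW.
apply: (le_trans (ler_wpM2r (expR_ge0 _) (entropy_le N))).
rewrite -expRD ler_expR.
have -> : (lam * Num.sqrt N%:R) ^+ 2 * (c / 4 * N%:R) / (16 * (4 * tau * N%:R)) =
    (lam ^+ 2 * c / 768 / tau) * (3 * N%:R).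
  by rewrite exprMn sqr_sqrtr ?(ltW NR)//; field; rewrite !gt_eqF.
have r1 : 1 <= lam ^+ 2 * c / 768 / tau by rewrite ler_pdivlMr// mul1r.
have : 1 * (3 * N%:R) <= lam ^+ 2 * c / 768 / tau * (3 * N%:R).
  by rewrite ler_wpM2r// mulr_ge0.
set y := _ / tau * _; clear; lra.
Unshelve. all: by end_near. Qed.

Lemma near_spreading (p kappa eta : R) : 0 < p <= 1 -> 0 < kappa <= 1 -> 0 < eta ->
  \forall N \near \oo, Pbern p (fun J : couplings N => ~~ spreading p kappa J) <= eta.
Proof.
move=> /andP[p0 p1] /andP[k0 k1] eta0.
have p01 : 0 <= p <= 1 by rewrite ltW.
have a0 : 0 < p ^+ 3 * kappa ^+ 2 / 512.
  by rewrite divr_gt0 ?ltr0n// mulr_gt0// exprn_gt0.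
near=> N; have N0 : (0 < N)%N by near: N; exact: nbhs_infty_ge.
have NR : 0 < N%:R :> R by rewrite ltr0n.
have F6 : 2 <= kappa * N%:R.
  by rewrite mulrC -ler_pdivrMr//; near: N; exact: nbhs_infty_ger.
have b0 : 0 < p / 8 by rewrite divr_gt0.
have L0 : 0 < p * kappa * N%:R / 2 by rewrite divr_gt0// !mulr_gt0.
have LV : p * kappa * N%:R / 2 <= N%:R.
  have : p * kappa * N%:R <= 1 * 1 * N%:R.
    by rewrite ler_wpM2r ?(ltW NR)//; apply: ler_pM => //; exact: ltW.
  by move: NR; clear; lra.
have vs (s : config N) : kappa * N%:R <= magn s ->
    (forall k, `|spin R s k| <= 2) /\ \sum_k (spin R s k) ^+ 2 <= N%:R.
  move=> _; split=> [k|].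
    by rewrite /spin; case: (s k); rewrite ?normrN normr1; clear; lra.
  under eq_bigr do rewrite expr2 spin_sqr.
  by rewrite sumr_const card_ord.
have := mixing_uniform p01 N0 b0 L0 LV vs.
rewrite card_config natrX => h.
have small : expR (2 * N%:R - (p ^+ 3 * kappa ^+ 2 / 512) * N%:R ^+ 2) <= eta.
  by near: N; exact: near_exp_sqr.
apply: le_trans small; apply: (le_trans _ (le_trans h _)).
  apply: le_Pbern => // J; rewrite /spreading negb_forall => /existsP[s].
  rewrite negb_imply -ltNge => /andP[Ms hs]; apply/existsP; exists s.
  rewrite Ms (le_trans (ltW hs))//= ler_nat.
  apply: subset_leq_card; apply/fintype.subsetP => i; rewrite !inE => /le_trans; apply.
  have si : spin R s i <= 1 by rewrite /spin; case: (s i); clear; lra.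
  rewrite -/(magn s).
  have : p * (kappa * N%:R - 1) <= p * (magn s - spin R s i).
    by rewrite ler_pM2l//; move: Ms si; clear; lra.
  have : p * 2 <= p * (kappa * N%:R) by rewrite ler_pM2l.
  by clear; lra.
apply: (le_trans (ler_wpM2r (expR_ge0 _) (entropy_le N))).
rewrite -expRD ler_expR lerD2l lerN2 le_eqVlt; apply/orP; left; apply/eqP.
by field; rewrite gt_eqF.
Unshelve. all: by end_near. Qed.

Lemma near_dense (p eta : R) : 0 < p <= 1 -> 0 < eta ->
  \forall N \near \oo, Pbern p (fun J : couplings N => ~~ dense p J) <= eta.
Proof.
move=> /andP[p0 p1] eta0; have p01 : 0 <= p <= 1 by rewrite ltW.
have a0 : 0 < p ^+ 2 / 256 by rewrite divr_gt0 ?ltr0n// exprn_gt0.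
near=> N; have N4 : 4 <= N%:R :> R by near: N; exact: nbhs_infty_ger.
have small : N%:R * expR (- ((p ^+ 2 / 256) * N%:R)) <= eta.
  by near: N; exact: near_mul_exp.
apply: le_trans small.
have -> : (p ^+ 2 / 256) * N%:R = p ^+ 2 * N%:R / 256 by field.
apply: le_trans (min_degree p01 N4 p0); apply: le_Pbern => // J.
by rewrite /dense negb_forall => /existsP[i hi]; apply/existsP; exists i; rewrite leNgt.
Unshelve. all: by end_near. Qed.

(** The first phase lasts [tau * N] steps, few enough for the fields to stay
    under uniform control, and brings the magnetization above
    [2 * kappa * N]; the second one ends in the absorbing state. *)
Lemma absorption (p eps eta : R) : 0 < p < 1 -> 0 < eps <= 1 -> 0 < eta ->
  \forall N \near \oo, forall s0 : config N, eps * Num.sqrt N%:R <= magn s0 ->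
  exists t (G : pred (couplings N)), Pbern p (fun J => ~~ G J) <= eta /\
    forall J, G J -> (forall i, flip_prob R J (all_plus N) i = 0) /\
      evolve J t (@unabsorbed R N) s0 <= eta.
Proof.
move=> p01 eps01 eta0; have [lam [c [lam0 c01 Hb]]] := near_biased p01 eps01.
have /andP[p0 p1] := p01; have /andP[eps0 eps1] := eps01; have /andP[c0 c1] := c01.
have p01w : 0 <= p <= 1 by rewrite !ltW.
have pp1 : 0 < p <= 1 by rewrite p0 ltW.
(* [tau <= c / 4] keeps the plus spins fewer than the positive fields, and
   [tau <= lam ^+ 2 * c / 768] is the price of [stable]; [kappa] is what a drift
   of order [th1] gains in [tau * N] steps. *)
have [tau [tau0 tauc taul]] :
    exists tau, [/\ 0 < tau, tau <= c / 4 & tau <= lam ^+ 2 * c / 768].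
  exists (Num.min (c / 4) (lam ^+ 2 * c / 768)); split.
  - by rewrite lt_min; apply/andP; split;
      rewrite divr_gt0 ?ltr0n// mulr_gt0// exprn_gt0.
  - by rewrite ge_min lexx.
  - by rewrite ge_min lexx orbT.
have [th1 th1E] : exists th1, th1 = c / 32 by eexists.
have th10 : 0 < th1 by rewrite th1E divr_gt0.
have [kappa kE] : exists kappa, kappa = th1 * tau by eexists.
have kappa0 : 0 < kappa by rewrite kE mulr_gt0.
have ktau : kappa <= tau by rewrite kE ler_piMl ?(ltW tau0)// th1E; clear -c1; lra.
have kt : kappa + tau <= c / 2 by clear -ktau tauc; lra.
have k01 : 0 < kappa <= 1 by rewrite kappa0; clear -ktau tauc c1; lra.
pose th := p / 64; have th0 : 0 < th by rewrite divr_gt0.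
have th1' : th <= 1 by rewrite /th; clear -p1; lra.
have e4 : 0 < eta / 4 by rewrite divr_gt0.
near=> N => s0 Ms0.
have N1 : 1 <= N%:R :> R by near: N; exact: nbhs_infty_ger.
have NR : 0 < N%:R :> R by exact: lt_le_trans N1.
have N0 : (0 < N)%N by rewrite -(ltr0n R).
have F1 : 2 <= lam * Num.sqrt N%:R.
  by rewrite mulrC -ler_pdivrMr//; near: N; exact: near_sqrt_ge.
have F7 : 2 <= tau * N%:R.
  by rewrite mulrC -ler_pdivrMr//; near: N; exact: nbhs_infty_ger.
have PA : Pbern p (fun J => ~~ biased lam c s0 J) <= eta / 4.
  by move: (s0) Ms0; near: N; exact: Hb.
have P3 : Pbern p (fun J => ~~ stable p lam c tau s0 J) <= eta / 4.
  by move: (s0); near: N; exact: near_stable.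
have P1 : Pbern p (fun J : couplings N => ~~ spreading p kappa J) <= eta / 4.
  by near: N; exact: near_spreading.
have Pd : Pbern p (fun J : couplings N => ~~ dense p J) <= eta / 4.
  by near: N; exact: near_dense.
have u1 : expR (- (th * kappa * N%:R)) <= eta / 4.
  by near: N; apply: near_exp => //; rewrite mulr_gt0.
have u2 : expR (th * N%:R - th ^+ 2 * N%:R ^+ 2) <= eta / 4.
  by near: N; apply: near_exp_sqr => //; rewrite exprn_gt0.
have u3 : expR (- (th1 * lam * Num.sqrt N%:R)) <= eta / 4.
  by near: N; apply: near_exp_sqrt => //; rewrite mulr_gt0.
have u4 : expR (- (2 * th1 ^+ 2 * tau * N%:R)) <= eta / 4.
  by near: N; apply: near_exp => //; rewrite !mulr_gt0// exprn_gt0.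
pose G (J : couplings N) :=
  [&& biased lam c s0 J, stable p lam c tau s0 J, spreading p kappa J & dense p J].
have PG : Pbern p (fun J => ~~ G J) <= eta.
  have -> : (fun J => ~~ G J) = (fun J => [|| ~~ biased lam c s0 J,
      ~~ stable p lam c tau s0 J, ~~ spreading p kappa J | ~~ dense p J]).
    by apply/funext => J; rewrite /G !negb_and.
  apply: (le_trans (PbernU p01w _ _)); apply: (le_trans (lerD PA
    (le_trans (PbernU p01w _ _) (lerD P3 (le_trans (PbernU p01w _ _)
    (lerD P1 Pd)))))).
  by clear; lra.
clear PA P3 P1 Pd.
have macro (J : couplings N) : G J ->
    (forall i, flip_prob R J (all_plus N) i = 0) /\
    forall s : config N, 2 * (kappa * N%:R) <= magn s ->
      evolve J (N ^ 3) (@unabsorbed R N) s <= eta / 4 + eta / 4.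
  move=> /and4P[_ _ /forallP G1 /forallP Hdeg].
  have Hexc s := implyP (G1 s).
  have [fp bound] := macroscopic_absorption N0 pp1 Hdeg Hexc.
  split => // s Ms; apply: (le_trans (bound (N ^ 3)%N s)); rewrite -/th mulrDl.
  have phile : expmagn th s <= expR (- (th * (2 * (kappa * N%:R)))).
    by rewrite ler_expR lerN2 ler_pM2l.
  apply: lerD.
    apply: le_trans (ler_wpM2l (expR_ge0 _) phile) _; rewrite -expRD.
    by apply: le_trans u1; rewrite ler_expR; clear; lra.
  apply: le_trans u2; rewrite -mulrA.
  have phi1 : expmagn th s <= 1.
    by apply: (le_trans phile); rewrite -expR0 ler_expR oppr_le0 !mulr_ge0// ltW.
  have r01 : 0 <= th ^+ 2 / N%:R <= 1.
    rewrite divr_ge0 ?sqr_ge0 ?(ltW NR)//= ler_pdivrMr// mul1r.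
    by apply: le_trans N1; rewrite expr_le1// ltW.
  apply: (@le_trans _ _ (expR (- ((N ^ 3)%:R * (th ^+ 2 / N%:R))) * (expR (th * N%:R) * 1))).
    apply: ler_pM; rewrite ?mulr_ge0 ?expR_ge0//.
    - by rewrite exprn_ge0// subr_ge0; case/andP: r01.
    - exact: exp_contraction.
    - by rewrite ler_wpM2l// expR_ge0.
  rewrite mulr1 -expRD ler_expR natrX.
  have -> : N%:R ^+ 3 * (th ^+ 2 / N%:R) = th ^+ 2 * N%:R ^+ 2.
    by clear -NR; field; rewrite gt_eqF.
  by rewrite addrC.
have [big|low] := leP (2 * (kappa * N%:R)) (magn s0).
  exists (N ^ 3)%N, G; split => // J /macro[fp h]; split => //.
  by apply: (le_trans (h s0 big)); clear -eta0; lra.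
pose T := Num.truncn (tau * N%:R).
have /andP[TN TN1] : T%:R <= tau * N%:R < T.+1%:R.
  by apply: truncn_itv; apply: le_trans F7.
have TN2 : tau * N%:R / 2 <= T%:R.
  by move: TN1 F7; rewrite -natr1; clear; lra.
exists (T + N ^ 3)%N, G; split => // J GJ; have [fp h] := macro J GJ; split => //.
rewrite /evolve iterD -/(evolve J (N ^ 3) (@unabsorbed R N)).
rewrite -/(evolve J T (evolve J (N ^ 3) (@unabsorbed R N))).
move: GJ => /and4P[HA /forallP G3 _ _].
have H3 s := implyP (G3 s).
have eta2 : 0 <= eta / 4 + eta / 4 by rewrite addr_ge0// ltW.
have := initial_growth N0 pp1 F1 c01 kt (ltW low) eta2 HA H3
  (fun s => evolve_le1 J N0 (N ^ 3) s (@unabsorbed_le1 R N)) h TN.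
move=> /le_trans; apply; rewrite -th1E mulrDl /expmagn -!mulrA -!expRD.
have M0 : 0 <= magn s0 :> R by apply: le_trans Ms0; rewrite mulr_ge0// ltW.
have t1 : expR (th1 * (magn s0 - lam * Num.sqrt N%:R) + - (th1 * magn s0)) <= eta / 4.
  by apply: le_trans u3; rewrite ler_expR; clear; lra.
have t2 : (1 - 8 * th1 ^+ 2) ^+ T *
    expR (th1 * (2 * (kappa * N%:R)) + - (th1 * magn s0)) <= eta / 4.
  have r01 : 0 <= 8 * th1 ^+ 2 <= 1.
    rewrite mulr_ge0 ?sqr_ge0//=.
    have : th1 ^+ 2 <= 8^-1 ^+ 2.
      rewrite lerXn2r ?nnegrE ?(ltW th10)//.
      by rewrite th1E; clear -c1; lra.
    by clear; lra.
  apply: le_trans (ler_wpM2r (expR_ge0 _) (exp_contraction T r01)) _.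
  rewrite -expRD; apply: le_trans u4; rewrite ler_expR.
  have : 0 <= th1 * magn s0 by rewrite mulr_ge0// ltW.
  have : tau * N%:R / 2 * (8 * th1 ^+ 2) <= T%:R * (8 * th1 ^+ 2).
    by rewrite ler_wpM2r// mulr_ge0 ?sqr_ge0.
  by rewrite kE; clear; lra.
by move: t1 t2; clear; lra.
Unshelve. all: by end_near. Qed.

End large_systems.

(** * The dynamical order parameter *)

Section order_parameter.
Context {R : realType} (p : R).
Hypothesis p01 : 0 < p < 1.

Let p01w : 0 <= p <= 1. Proof. by case/andP: p01 => p0 p1; rewrite !ltW. Qed.

Lemma le_E_init N (f g : config N -> R) : (forall s, f s <= g s) ->
  E_init f <= E_init g.
Proof. by move=> fg; rewrite ler_wpM2l ?invr_ge0//; exact: ler_sum. Qed.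

Lemma E_init_affine N (a b : R) (f : config N -> R) :
  E_init (fun s => a + b * f s) = a + b * E_init f.
Proof.
rewrite /E_init big_split /= sumr_const -mulr_sumr mulrDr mulrCA; congr (_ + _).
rewrite -[a *+ _]mulr_natl mulKf// pnatr_eq0 card_config expn_eq0.
by [].
Qed.

(** Nonnegativity of the variance. *)
Lemma Ebern_sqr_le (E : finType) (f : {ffun E -> bool} -> R) :
  Ebern p f ^+ 2 <= Ebern p (fun J => f J ^+ 2).
Proof.
have := Ebern_ge0 p01w (fun J => sqr_ge0 (f J - Ebern p f)).
rewrite (@eq_Ebern _ _ _ _ (fun J => f J ^+ 2 + (- (2 * Ebern p f) * f J +
   Ebern p f ^+ 2))); last by move=> J; ring.
rewrite !EbernD EbernZ Ebern_cst; nra.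
Qed.

Variable n : nat.
Variable X : forall (J : couplings n.+1) (s0 : config n.+1),
  zero_temp_dynamics R J s0.

(** The chain ends in [a] with probability at least [1 - eta] for the couplings
    in [G], and the exceptional couplings cost at most [2 * eta]. *)
Lemma E_couplings_absorbed (G : pred (couplings n.+1)) (a s0 : config n.+1)
    (eta : R) : 0 <= eta -> Pbern p (fun J => ~~ G J) <= eta ->
  (forall J, G J -> (forall i, flip_prob R J a i = 0) /\
     exists t, evolve J t (fun s => (s != a)%:R) s0 <= eta) ->
  1 - 4 * eta <= (if a ord0 then 1 else -1) * E_couplings p (fun J => E_omega (X J s0)).
Proof.
move=> eta0 PG HG; set sg : R := if _ then _ else _.
have -> : sg * E_couplings p (fun J => E_omega (X J s0)) =
   Ebern p (fun J => sg * E_omega (X J s0)) by rewrite EbernZ.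
apply: (@le_trans _ _ (Ebern p (fun J => (1 - 2 * eta) + - 2 * (~~ G J)%:R))).
  by rewrite EbernD EbernZ Ebern_cst; move: PG; rewrite /Pbern; lra.
apply: le_Ebern => // J; have [GJ|GJ] := boolP (G J).
  have [fp [t ht]] := HG J GJ.
  have := E_omega_absorbed (X J s0) t fp; rewrite -/sg /=.
  by move: ht; lra.
have : `|sg * E_omega (X J s0)| <= 1.
  rewrite normrM (_ : `|sg| = 1) ?mul1r; first exact: normr_E_omega.
  by rewrite /sg; case: ifP; rewrite ?normrN normr1.
by rewrite ler_norml => /andP[h _] /=; lra.
Qed.

Lemma q_D_annealed_le : q_D_annealed p X <= q_D p X.
Proof. by apply: le_E_init => s; exact: Ebern_sqr_le. Qed.

Lemma q_D_le1 : q_D p X <= 1.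
Proof.
apply: (@le_trans _ _ (E_init (fun _ : config n.+1 => 1 + 0 * 0))); last first.
  by rewrite E_init_affine mul0r addr0.
apply: le_E_init => s; rewrite mul0r addr0 -[leRHS](Ebern_cst p (edge n.+1)).
apply: le_Ebern => // J; have := normr_E_omega (X J s).
by rewrite -[_ ^+ 2]real_normK ?num_real// => h; rewrite expr_le1.
Qed.

End order_parameter.

(** The chain is absorbed at the sign of [magn s0] when [magn s0] is not small;
    the negative case is the positive one seen through a global flip. *)
Lemma q_D_annealed_lower (R : realType) (p eps eta : R) (n : nat)
    (X : forall (J : couplings n.+1) (s0 : config n.+1), zero_temp_dynamics R J s0) :
  0 < p < 1 -> 0 < eps -> 0 < eta <= 4^-1 ->
  (forall s0 : config n.+1, eps * Num.sqrt n.+1%:R <= magn s0 ->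
    exists t (G : pred (couplings n.+1)), Pbern p (fun J => ~~ G J) <= eta /\
    forall J, G J -> (forall i, flip_prob R J (all_plus n.+1) i = 0) /\
      evolve J t (@unabsorbed R n.+1) s0 <= eta) ->
  1 - 8 * eta - eps - (Num.sqrt n.+1%:R)^-1 <= q_D_annealed p X.
Proof.
move=> p01 eps0 /andP[eta0 eta1] H.
have x0 : 0 < Num.sqrt n.+1%:R :> R by rewrite sqrtr_gt0 ltr0n.
have w0 : 0 <= eps * Num.sqrt n.+1%:R :> R by rewrite mulr_ge0// ltW.
pose small (s : config n.+1) : R := (`|magn s| < eps * Num.sqrt n.+1%:R)%R%:R.
apply: (@le_trans _ _ (E_init (fun s => (1 - 8 * eta) + -1 * small s))).
  rewrite E_init_affine; have := init_small_magn (ltn0Sn n) w0; rewrite -/small.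
  have -> : (eps * Num.sqrt n.+1%:R + 1) / Num.sqrt n.+1%:R =
      eps + (Num.sqrt n.+1%:R)^-1 :> R by field; rewrite gt_eqF.
  by move: (E_init _) => e; clear; lra.
apply: le_E_init => s0; rewrite /small.
case: ltP => hM; first by apply: le_trans (sqr_ge0 _); rewrite mulr1; clear -eta0; lra.
suff [a ha] : exists a : config n.+1, 1 - 4 * eta <= (if a ord0 then 1 else -1) *
    E_couplings p (fun J => E_omega (X J s0)).
  move: ha; set q := E_couplings _ _ => ha; rewrite mulr0 addr0.
  have : (1 - 4 * eta) ^+ 2 <= ((if a ord0 then 1 else -1) * q) ^+ 2.
    have h0 : 0 <= 1 - 4 * eta by clear -eta1; lra.
    by rewrite lerXn2r ?nnegrE// (le_trans h0).
  have -> : ((if a ord0 then 1 else -1) * q) ^+ 2 = q ^+ 2.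
    by case: (a ord0); rewrite ?mul1r ?mulN1r ?sqrrN.
  by apply: le_trans; have := sqr_ge0 eta; clear; lra.
have := real_normK (num_real (magn s0 : R)).
have [M0|M0] := leP 0 (magn s0 : R).
  rewrite (ger0_norm M0) in hM; have [t [G [PG HG]]] := H s0 hM => _.
  exists (all_plus n.+1); apply: (E_couplings_absorbed p01 X (ltW eta0) PG).
  by move=> J /HG[fp ev]; split => //; exists t.
rewrite (ltr0_norm M0) -magn_negate in hM; have [t [G [PG HG]]] := H _ hM => _.
exists (negate (all_plus n.+1)).
apply: (E_couplings_absorbed p01 X (ltW eta0) PG) => J /HG[fp ev]; split.
  by move=> i; rewrite flip_prob_negate.
exists t; rewrite -evolve_negate// in ev; move: ev; congr (_ <= _).
congr (evolve J t _ s0); apply/funext => s; rewrite /unabsorbed; congr (_%:R).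
congr (~~ _); apply/eqP/eqP => [<-|->]; apply/ffunP => i; by rewrite !ffunE// negbK.
Qed.

Theorem corollary1p1 (R : realType) (p : R) (hp : 0 < p < 1)
    (X : forall (n : nat) (J : couplings n.+1) (s0 : config n.+1),
         zero_temp_dynamics R J s0) :
  (q_D p (X n) @[n --> \oo] --> (1 : R)) /\
  (q_D_annealed p (X n) @[n --> \oo] --> (1 : R)).
Proof.
have lower e : 0 < e -> \forall n \near \oo, 1 - e <= q_D_annealed p (X n).
  move=> e0; pose d := Num.min (e / 16) 8^-1.
  have d0 : 0 < d by rewrite lt_min divr_gt0 ?ltr0n//= invr_gt0.
  have de : d <= e / 16 by rewrite ge_min lexx.
  have d4 : d <= 8^-1 by rewrite ge_min lexx orbT.
  have d01 : 0 < d <= 1 by rewrite d0; clear -d4; lra.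
  have d04 : 0 < d <= 4^-1 by rewrite d0; clear -d4; lra.
  have [N1 _ absN] := absorption hp d01 d0.
  have [N2 _ sqN] := near_sqrt_ge d^-1.
  exists (maxn N1 N2) => // n /=; rewrite geq_max => /andP[n1 n2].
  have x0 : 0 < d^-1 by rewrite invr_gt0.
  have sq : (Num.sqrt n.+1%:R)^-1 <= d.
    have h := sqN n.+1 (leqW n2).
    by rewrite -[leRHS]invrK lef_pV2 ?posrE// (lt_le_trans x0).
  apply: le_trans (q_D_annealed_lower (X n) hp d0 d04 (absN n.+1 (leqW n1))).
  by move: sq de e0; clear; lra.
have le1 n : q_D_annealed p (X n) <= 1.
  exact: le_trans (q_D_annealed_le hp (X n)) (q_D_le1 hp (X n)).
split; apply/cvgrPdist_le => e e0; near=> n.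
  have h : 1 - e <= q_D_annealed p (X n) by near: n; exact: lower.
  have h1 := q_D_annealed_le hp (X n); have h2 := q_D_le1 hp (X n).
  by rewrite ger0_norm ?subr_ge0// lerBlDr -lerBlDl (le_trans h).
have h : 1 - e <= q_D_annealed p (X n) by near: n; exact: lower.
by rewrite ger0_norm ?subr_ge0// lerBlDr -lerBlDl.
Unshelve. all: by end_near. Qed.
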